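(* Let $(M,g_L,Z,\lambda,\rho)$ be a Lyra almost Ricci--Bourguignon soliton on a connected Lyra twisted warped product $M=M_1\times_fM_2$ of dimension $n\ge3$. If $Z$ is Lyra Killing, then $g_L$ is Einstein, $\operatorname{Ric}^L=\mu g_L$ with $\mu$ constant, and $$\lambda=(1-n\rho)\mu .$$ Consequently $\lambda$ is constant. If $\rho\neq\frac1n$, then $\mu=\frac{\lambda}{1-n\rho}$. If $\rho=\frac1n$, then necessarily $\lambda=0$.
   Context: Lyra twisted warped product: $(M_1,g_1),(M_2,g_2)$ are smooth pseudo-Riemannian manifolds of positive dimensions $n_1,n_2$, $n=n_1+n_2$; $f,\varphi:M_1\times M_2\to(0,\infty)$ are smooth; $M=M_1\times M_2$ carries $g=g_1\oplus f^2g_2$ and $g_L=\varphi^2g$. $\operatorname{Ric}^L,R^L$ are the Ricci tensor and scalar curvature of $g_L$. A Lyra almost Ricci--Bourguignon soliton is $(g_L,Z,\lambda,\rho)$ with $Z$ a smooth vector field on $M$, $\lambda\in C^\infty(M)$, $\rho\in\mathbb R$, satisfying $\operatorname{Ric}^L+\frac12\mathcal L_Zg_L=(\lambda+\rho R^L)g_L$. $Z$ is Lyra Killing if $\mathcal L_Zg_L=0$. $g_L$ is Einstein if $\operatorname{Ric}^L=\mu g_L$ for some constant $\mu\in\mathbb R$. *)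

(* Defs.v *)
From HB Require Import structures.
From mathcomp Require Import all_boot all_order all_algebra.
From mathcomp Require Import all_classical all_reals all_analysis.

Set Implicit Arguments.
Unset Strict Implicit.
Unset Printing Implicit Defensive.

Import Order.TTheory GRing.Theory Num.Theory.
Import numFieldNormedType.Exports.

Local Open Scope classical_set_scope.
Local Open Scope ring_scope.

Definition partial (R : realType) (n : nat) (i : 'I_n) (h : 'rV[R]_n -> R)
  : 'rV[R]_n -> R := fun x => 'D_(delta_mx 0 i) h x.

(* C^oo on an open set U: the iterated partial derivatives of all orders
   (s lists the directions, s = [::] being h itself) are differentiable, hence
   continuous, at every point of U. *)
Definition smooth_on (R : realType) (n : nat) (U : set 'rV[R]_n)
    (h : 'rV[R]_n -> R) : Prop :=
  forall (s : seq 'I_n) (x : 'rV[R]_n), U x ->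
    differentiable (foldr (@partial R n) h s) x.

(* An n-dimensional smooth manifold (Hausdorff, second countable), given by an
   indexed atlas which need not be maximal. In the chart i, [coord i] is
   meaningful on [dom i] only, and [param i] is its inverse, meaningful on
   [coord i @` dom i] only. *)
Record manifold (R : realType) (n : nat) := Manifold {
  carrier :> topologicalType ;
  atlas : Type ;
  dom : atlas -> set carrier ;
  coord : atlas -> carrier -> 'rV[R]_n ;
  param : atlas -> 'rV[R]_n -> carrier ;
  manifold_hausdorff : hausdorff_space carrier ;
  manifold_countable : @second_countable carrier ;
  dom_cover : forall p, exists i, dom i p ;
  dom_open : forall i, open (dom i) ;
  img_open : forall i, open (coord i @` dom i) ;
  coordK : forall i p, dom i p -> param i (coord i p) = p ;
  coord_cont : forall i p, dom i p -> {for p, continuous (coord i)} ;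
  param_cont : forall i x, (coord i @` dom i) x ->
    {for x, continuous (param i)} ;
  transition_smooth : forall i j k,
    smooth_on (coord i @` dom i `&` param i @^-1` dom j)
              (fun x => coord j (param i x) 0 k)
}.

Arguments atlas {R n} m.
Arguments dom {R n m} i.
Arguments coord {R n m} i.
Arguments param {R n m} i.

Section Fields.
Variables (R : realType) (n : nat) (M : manifold R n).

Definition img (i : atlas M) : set 'rV[R]_n := coord i @` dom i.

Definition overlap (i j : atlas M) : set 'rV[R]_n :=
  img i `&` param i @^-1` dom j.

Definition transition (i j : atlas M) : 'rV[R]_n -> 'rV[R]_n :=
  fun x => coord j (param i x).

Definition smooth_fun (h : M -> R) : Prop :=
  forall i : atlas M, smooth_on (img i) (fun x => h (param i x)).

(* Tensor fields are families of components: one function of the coordinates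
   for each chart i, meaningful on [img i] only. *)
Definition vector_field := atlas M -> 'rV[R]_n -> 'rV[R]_n.
Definition tensor02 := atlas M -> 'rV[R]_n -> 'M[R]_n.

(* ['J f x] acts on row vectors from the right: 'd f x v = v *m 'J f x. *)
Definition smooth_vector_field (Z : vector_field) : Prop :=
  (forall i k, smooth_on (img i) (fun x => Z i x 0 k)) /\
  (forall i j x, overlap i j x ->
     Z j (transition i j x) = Z i x *m 'J (transition i j) x).

Definition pseudo_riemannian (g : tensor02) : Prop :=
  [/\ forall i a b, smooth_on (img i) (fun x => g i x a b),
      forall i x, img i x -> (g i x)^T = g i x,
      forall i x, img i x -> g i x \in unitmx
    & forall i j x, overlap i j x ->
        g i x = 'J (transition i j) x *m g j (transition i j x)
                  *m ('J (transition i j) x)^T].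

(* Christoffel symbols Gamma^k_ab of the Levi-Civita connection. *)
Definition christoffel (g : tensor02) (i : atlas M) (k a b : 'I_n)
    (x : 'rV[R]_n) : R :=
  2^-1 * \sum_(l < n) invmx (g i x) k l *
    (partial a (fun y => g i y b l) x + partial b (fun y => g i y a l) x
     - partial l (fun y => g i y a b) x).

(* The component R^l_cab of the curvature tensor
   R(X, Y) V = nabla_X nabla_Y V - nabla_Y nabla_X V - nabla_[X, Y] V,
   i.e., R(d_a, d_b) d_c = \sum_l R^l_cab d_l. *)
Definition curvature (g : tensor02) (i : atlas M) (l c a b : 'I_n)
    (x : 'rV[R]_n) : R :=
  partial a (christoffel g i l b c) x - partial b (christoffel g i l a c) x
  + \sum_(m < n) (christoffel g i l a m x * christoffel g i m b c x
                  - christoffel g i l b m x * christoffel g i m a c x).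

(* Ric(Y, V) = tr (X |-> R(X, Y) V) *)
Definition ricci (g : tensor02) : tensor02 := fun i x =>
  \matrix_(b < n, c < n) \sum_(a < n) curvature g i a c a b x.

Definition scalar_curvature (g : tensor02) (i : atlas M) (x : 'rV[R]_n) : R :=
  \sum_(b < n) \sum_(c < n) invmx (g i x) b c * ricci g i x b c.

(* (L_Z g)(d_a, d_b) = Z (g (d_a, d_b)) - g ([Z, d_a], d_b) - g (d_a, [Z, d_b])
   with [Z, d_a] = - \sum_k (d_a Z^k) d_k. *)
Definition lie_derivative (Z : vector_field) (g : tensor02) : tensor02 :=
  fun i x => \matrix_(a < n, b < n) \sum_(k < n)
    (Z i x 0 k * partial k (fun y => g i y a b) x
     + partial a (fun y => Z i y 0 k) x * g i x k b
     + partial b (fun y => Z i y 0 k) x * g i x a k).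

Definition killing (Z : vector_field) (g : tensor02) : Prop :=
  forall i x, img i x -> lie_derivative Z g i x = 0.

Definition almost_ricci_bourguignon_soliton
    (g : tensor02) (Z : vector_field) (lambda : M -> R) (rho : R) : Prop :=
  forall i x, img i x ->
    ricci g i x + 2^-1 *: lie_derivative Z g i x
      = (lambda (param i x) + rho * scalar_curvature g i x) *: g i x.

Definition einstein_with (g : tensor02) (mu : R) : Prop :=
  forall i x, img i x -> ricci g i x = mu *: g i x.

End Fields.

Lemma foldr_partial_linear (R : realType) (m n : nat)
    (L : {linear 'rV[R]_m -> 'rV[R]_n}) (h : 'rV[R]_n -> R) (s : seq 'I_m) :
  (forall i, (exists j, L (delta_mx 0 i) = delta_mx 0 j) \/
             L (delta_mx 0 i) = 0) ->
  (exists s', foldr (@partial R m) (h \o L) s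
              = foldr (@partial R n) h s' \o L) \/
  foldr (@partial R m) (h \o L) s = cst 0.
Proof.
move=> HL; elim: s => [|i s [[s' IH]|IH]] /=; first by left; exists [::].
  rewrite IH; have [[j Lj]|L0] := HL i.
    left; exists (j :: s'); apply/funext => x /=.
    rewrite /partial /derive /=.
    by under eq_fun do rewrite linearP Lj.
  right; apply/funext => x; rewrite /partial /derive /=.
  under eq_fun do rewrite linearP L0 scaler0 add0r subrr scaler0.
  exact: lim_cst.
by right; rewrite IH; apply/funext => x; rewrite /partial derive_cst.
Qed.

Lemma smooth_on_linear (R : realType) (m n : nat)
    (L : {linear 'rV[R]_m -> 'rV[R]_n}) (U : set 'rV[R]_n)
    (V : set 'rV[R]_m) (h : 'rV[R]_n -> R) :
  continuous L ->
  (forall i, (exists j, L (delta_mx 0 i) = delta_mx 0 j) \/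
             L (delta_mx 0 i) = 0) ->
  V `<=` L @^-1` U ->
  smooth_on U h -> smooth_on V (h \o L).
Proof.
move=> cL HL VU hU s x Vx.
have [[s' ->]|->] := foldr_partial_linear h s HL; last exact: differentiable_cst.
apply: differentiable_comp; first exact: linear_differentiable.
exact: hU (VU _ Vx).
Qed.

Section ProductManifold.
Variables (R : realType) (n1 n2 : nat).
Variables (M1 : manifold R n1) (M2 : manifold R n2).

Local Notation T := (M1 * M2)%type.
Local Notation A := (atlas M1 * atlas M2)%type.

Definition product_dom (c : A) : set T := dom c.1 `*` dom c.2.

Definition product_coord (c : A) (p : T) : 'rV[R]_(n1 + n2) :=
  row_mx (coord c.1 p.1) (coord c.2 p.2).

Definition product_param (c : A) (x : 'rV[R]_(n1 + n2)) : T :=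
  (param c.1 (lsubmx x), param c.2 (rsubmx x)).

Lemma product_hausdorff : hausdorff_space T.
Proof.
move=> [p1 p2] [q1 q2] pq; congr pair.
- apply: (@manifold_hausdorff _ _ M1) => U V Up Vq.
  have [] := pq (U `*` setT) (V `*` setT).
  + by exists (U, setT) => //=; split => //; exact: filterT.
  + by exists (V, setT) => //=; split => //; exact: filterT.
  by move=> [z1 z2] [[/= Uz _] [/= Vz _]]; exists z1.
- apply: (@manifold_hausdorff _ _ M2) => U V Up Vq.
  have [] := pq (setT `*` U) (setT `*` V).
  + by exists (setT, U) => //=; split => //; exact: filterT.
  + by exists (setT, V) => //=; split => //; exact: filterT.
  by move=> [z1 z2] [[/= _ Uz] [/= _ Vz]]; exists z2.
Qed.

Lemma product_open (U : set M1) (V : set M2) :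
  open U -> open V -> open (U `*` V : set T).
Proof.
rewrite !openE => oU oV [p q] [/= Up Vq].
by exists (U, V) => //=; split; [exact: oU|exact: oV].
Qed.

Lemma product_second_countable : @second_countable T.
Proof.
have [B1 cB1 [oB1 bB1]] := @manifold_countable _ _ M1.
have [B2 cB2 [oB2 bB2]] := @manifold_countable _ _ M2.
pose S (UV : set M1 * set M2) : set T := UV.1 `*` UV.2.
exists (S @` (B1 `*` B2)).
  by apply: sub_countable (countableX cB1 cB2); exact: card_image_le.
split=> [_ [[U V] [/= BU BV] <-]|[p q] W [[U V] [/= nU nV] UVW]].
  by apply: product_open; [exact: oB1|exact: oB2].
have [U' [BU' U'p] U'U] := bB1 p U nU.
have [V' [BV' V'q] V'V] := bB2 q V nV.
exists (U' `*` V'); first by split => //; exists (U', V').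
by move=> [z1 z2] [/= Uz Vz]; apply: UVW; split; [exact: U'U|exact: V'V].
Qed.

Lemma product_imgE (c : A) :
  product_coord c @` product_dom c = lsubmx @^-1` img c.1 `&` rsubmx @^-1` img c.2.
Proof.
apply/seteqP; split=> [_ [[p q] [/= dp dq] <-]|x [[p dp xp] [q dq xq]]].
  by split; [exists p|exists q] => //=; rewrite ?row_mxKl ?row_mxKr.
by exists (p, q) => //; rewrite /product_coord/= xp xq hsubmxK.
Qed.

Lemma product_img_open (c : A) : open (product_coord c @` product_dom c).
Proof.
rewrite product_imgE; apply: openI; apply: open_comp;
  try exact: img_open; move=> x _.
  exact: continuous_lsubmx.
exact: continuous_rsubmx.
Qed.

Lemma product_coord_cont (c : A) (p : T) :
  product_dom c p -> {for p, continuous (product_coord c)}.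
Proof.
case: p => p q [/= dp dq] W [P nP PW].
have F : Filter (nbhs ((p, q) : T)) by exact: nbhs_filter.
suff : \forall z \near ((p, q) : T), forall a b, P a b (product_coord c z a b).
  by apply: filterS => z; exact: PW.
apply: (filter_forall F) => a; apply: (filter_forall F) => b.
move: (nP a b); rewrite /product_coord /= mxE.
case: (splitP b) => k bk nPk.
  have h : (fun z : T => coord c.1 z.1 a k) @ (p, q) --> coord c.1 p a k.
    apply: (@cvg_comp _ _ _ (fun z : T => coord c.1 z.1)
      (fun N : 'rV[R]_n1 => N a k) _ (nbhs (coord c.1 p)));
      last exact: coord_continuous.
    apply: (@cvg_comp _ _ _ fst (coord c.1) _ (nbhs p));
      [exact: cvg_fst|exact: coord_cont dp].
  apply: (@filterS _ _ F _ _ _ (h _ nPk)) => z /=.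
  by rewrite (_ : b = lshift n2 k) ?row_mxEl //; apply/val_inj.
have h : (fun z : T => coord c.2 z.2 a k) @ (p, q) --> coord c.2 q a k.
  apply: (@cvg_comp _ _ _ (fun z : T => coord c.2 z.2)
    (fun N : 'rV[R]_n2 => N a k) _ (nbhs (coord c.2 q)));
      last exact: coord_continuous.
  apply: (@cvg_comp _ _ _ snd (coord c.2) _ (nbhs q));
      [exact: cvg_snd|exact: coord_cont dq].
apply: (@filterS _ _ F _ _ _ (h _ nPk)) => z /=.
by rewrite (_ : b = rshift n1 k) ?row_mxEr //; apply/val_inj.
Qed.

Lemma product_param_cont (c : A) x :
  (product_coord c @` product_dom c) x -> {for x, continuous (product_param c)}.
Proof.
rewrite product_imgE => -[x1 x2].
have h1 : {for x, continuous (param c.1 \o lsubmx)}.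
  by apply: continuous_comp; [exact: continuous_lsubmx|exact: param_cont x1].
have h2 : {for x, continuous (param c.2 \o rsubmx)}.
  by apply: continuous_comp; [exact: continuous_rsubmx|exact: param_cont x2].
exact: cvg_pair h1 h2.
Qed.

Lemma product_transition_smooth (c d : A) k :
  smooth_on (product_coord c @` product_dom c `&`
             product_param c @^-1` product_dom d)
            (fun x => product_coord d (product_param c x) 0 k).
Proof.
rewrite product_imgE; case: (splitP k) => [a ka|b kb].
  rewrite (_ : k = lshift n2 a); last exact/val_inj.
  under [X in smooth_on _ X]eq_fun do rewrite row_mxEl.
  apply: (@smooth_on_linear _ _ _ (@lsubmx _ _ _ _) _ _ _ _ _ _
            (@transition_smooth _ _ M1 c.1 d.1 a)).
  - by move=> x; exact: continuous_lsubmx.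
  - move=> i; case: (splitP i) => j ij; [left; exists j|right].
      by apply/rowP => l; rewrite !mxE /= -!val_eqE /= ij.
    apply/rowP => l; rewrite !mxE /= -val_eqE /= ij.
    by rewrite ltn_eqF // (leq_trans (ltn_ord l)) ?leq_addr.
  - by move=> x [[? ?] [? ?]].
rewrite (_ : k = rshift n1 b); last exact/val_inj.
under [X in smooth_on _ X]eq_fun do rewrite row_mxEr.
apply: (@smooth_on_linear _ _ _ (@rsubmx _ _ _ _) _ _ _ _ _ _
          (@transition_smooth _ _ M2 c.2 d.2 b)).
- by move=> x; exact: continuous_rsubmx.
- move=> i; case: (splitP i) => j ij; [right|left; exists j].
    apply/rowP => l; rewrite !mxE /= -val_eqE /= ij.
    by rewrite gtn_eqF // (leq_trans (ltn_ord j)) ?leq_addr.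
  by apply/rowP => l; rewrite !mxE /= -!val_eqE /= ij eqn_add2l.
- by move=> x [[? ?] [? ?]].
Qed.

Lemma product_cover (p : T) : exists c : A, product_dom c p.
Proof.
have [i ip] := dom_cover p.1; have [j jp] := dom_cover p.2.
by exists (i, j).
Qed.

Lemma product_dom_open (c : A) : open (product_dom c).
Proof. by apply: product_open; exact: dom_open. Qed.

Lemma product_coordK (c : A) (p : T) :
  product_dom c p -> product_param c (product_coord c p) = p.
Proof.
case: p => p q [/= dp dq].
by rewrite /product_param row_mxKl row_mxKr !coordK.
Qed.

Definition product_manifold : manifold R (n1 + n2) :=
  Manifold product_hausdorff product_second_countable product_cover
    product_dom_open product_img_open product_coordK product_coord_cont
    product_param_cont product_transition_smooth.

(* g1 (+) f^2 g2: in a product chart the coordinate frame is the union of those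
   of the factors, whence the block form. *)
Definition twisted_warped_metric (g1 : tensor02 M1) (g2 : tensor02 M2)
    (f : product_manifold -> R) : tensor02 product_manifold :=
  fun c x => block_mx (g1 c.1 (lsubmx x)) 0
                      0 (f (param c x) ^+ 2 *: g2 c.2 (rsubmx x)).

Definition lyra_metric (g1 : tensor02 M1) (g2 : tensor02 M2)
    (f phi : product_manifold -> R) : tensor02 product_manifold :=
  fun c x => phi (param c x) ^+ 2 *: twisted_warped_metric g1 g2 f c x.

End ProductManifold.

(* Main.v *)
Require Import Defs.
From HB Require Import structures.
From mathcomp Require Import all_boot all_order all_algebra.
From mathcomp Require Import all_classical all_reals all_analysis.
From mathcomp Require Import ring lra.

Set Implicit Arguments.
Unset Strict Implicit.
Unset Printing Implicit Defensive.

Import Order.TTheory GRing.Theory Num.Theory.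
Import numFieldNormedType.Exports.

Local Open Scope classical_set_scope.
Local Open Scope ring_scope.

(* The Killing condition turns the soliton equation into Ric = mu g for a
   function mu, which is tr_g Ric / n, and it remains to see that mu is constant
   (Schur's lemma). In a chart, write A_a for the matrix of Christoffel symbols
   and F_ab = d_a A_b - d_b A_a + [A_b, A_a] for the curvature. The second
   Bianchi identity holds for any A. Since A is metric, raising an index makes
   F_ab skew, and contracting both indices of the raised identity turns Ric = mu g
   into (n - 2) d_c mu = 0; torsion-freeness kills or cancels the Christoffel
   terms. So mu is locally constant in each chart. When rho = 1/n the soliton
   equation does not determine mu from lambda, so that mu agrees on overlapping
   charts must come from the tensoriality of Ric: the Christoffel matrices
   transform by the gauge law A_a J = d_a J + J B_a, J being the Jacobian of the
   transition map and B the pulled-back connection. *)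

(** * Symmetry of second derivatives *)

Lemma is_derive_line (R : realType) (V W : normedModType R) (h : V -> W)
    (x v : V) (s : R) :
  derivable h (x + s *: v) v ->
  is_derive s 1 (fun t : R => h (x + t *: v)) ('D_v h (x + s *: v)).
Proof.
have E : (fun k : R => k^-1 *: (h (x + (k *: (1 : R) + s) *: v) - h (x + s *: v))) =
   (fun k : R => k^-1 *: (h (k *: v + (x + s *: v)) - h (x + s *: v))).
  apply/funext => k; congr (_ *: (h _ - _)).
  by rewrite scalerDl addrCA /GRing.scale /= mulr1.
move=> dh; apply: DeriveDef; first by rewrite /derivable E.
by rewrite /derive E.
Qed.

(** The mean value theorem is applied twice: along [v] to the difference of [h] on two parallel
    segments, which gives [xi], then along [w] to the derivative found there, which gives [eta]. The
    left-hand side is symmetric in [v] and [w], so the same quantity also expresses the derivatives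
    taken in the other order. *)
Lemma second_difference (R : realType) (V : normedModType R) (h : V -> R)
    (x v w : V) (r t : R) :
  (forall y, `|y - x| < r -> derivable h y v /\ derivable ('D_v h) y w) ->
  0 < t -> t * (`|v| + `|w|) < r ->
  exists2 p, `|p - x| < r &
    h (x + t *: v + t *: w) - h (x + t *: v) - h (x + t *: w) + h x
      = t ^+ 2 * 'D_w ('D_v h) p.
Proof.
move=> hr t0 tr.
have near_x (a b : R) : 0 <= a <= t -> 0 <= b <= t ->
    `|x + a *: v + b *: w - x| < r.
  move=> /andP[a0 at_] /andP[b0 bt].
  rewrite (_ : x + _ + _ - x = a *: v + b *: w); last first.
    by rewrite -(addrA x) (addrC x) addrK.
  apply: le_lt_trans tr; rewrite (le_trans (ler_normD _ _))// !normrZ mulrDr.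
  by rewrite !ger0_norm// lerD// ler_wpM2r.
have near_x' (a : R) : 0 <= a <= t -> `|x + a *: v - x| < r.
  by move=> at_; have := near_x a 0 at_; rewrite scale0r addr0 lexx ltW//; exact.
have in0t (a : R) : a \in `]0, t[ -> 0 <= a <= t.
  by rewrite in_itv /= => /andP[/ltW-> /ltW->].
have in0t' (a : R) : a \in `[0, t] -> 0 <= a <= t by rewrite in_itv.
have tt : 0 <= t <= t by rewrite lexx ltW.
pose phi (s : R) := h (x + t *: w + s *: v) - h (x + s *: v).
have dphi (s : R) : 0 <= s <= t ->
    is_derive s 1 phi ('D_v h (x + t *: w + s *: v) - 'D_v h (x + s *: v)).
  move=> st; apply: is_deriveB; apply: is_derive_line; apply: (hr _ _).1.
    by rewrite (addrAC x); exact: near_x.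
  exact: near_x'.
have [||xi xi_in Exi] := MVT t0 (f := phi)
    (df := fun s => 'D_v h (x + t *: w + s *: v) - 'D_v h (x + s *: v)).
- by move=> s /in0t; exact: dphi.
- by apply: derivable_within_continuous => s /in0t' /dphi[].
have xit := in0t _ xi_in.
pose psi (s : R) := 'D_v h (x + xi *: v + s *: w).
have dpsi (s : R) : 0 <= s <= t ->
    is_derive s 1 psi ('D_w ('D_v h) (x + xi *: v + s *: w)).
  move=> st; apply: (@is_derive_line _ _ _ ('D_v h)); apply: (hr _ _).2.
  exact: near_x.
have [||eta eta_in Eeta] := MVT t0 (f := psi)
    (df := fun s => 'D_w ('D_v h) (x + xi *: v + s *: w)).
- by move=> s /in0t; exact: dpsi.
- by apply: derivable_within_continuous => s /in0t' /dpsi[].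
exists (x + xi *: v + eta *: w); first exact: near_x (in0t _ eta_in).
move: Exi Eeta; rewrite /phi /psi !scale0r !addr0 !subr0.
rewrite (addrAC x (t *: w)) (addrAC x (t *: w)) => Exi Eeta.
transitivity (h (x + t *: v + t *: w) - h (x + t *: v) - (h (x + t *: w) - h x)).
  by ring.
by rewrite Exi Eeta; ring.
Qed.

(** The two evaluation points may differ, as they do for the two mean value points produced by a
    second difference. If the values at [x] were a distance [e] apart, closeness within [e / 2] on
    each side would give [e < e]. *)
Lemma continuous_eq_at (R : realType) (V : normedModType R) (F G : V -> R)
    (x : V) :
  {for x, continuous F} -> {for x, continuous G} ->
  (forall r : R, 0 < r -> exists y z,
    [/\ `|y - x| < r, `|z - x| < r & F y = G z]) ->
  F x = G x.
Proof.
move=> cF cG FG; apply/eqP; rewrite -subr_eq0 -normr_le0 leNgt.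
apply/negP => e0; set e := `|_| in e0.
have e2 : 0 < e / 2 by rewrite divr_gt0.
move/cvgrPdist_lt: cF => /(_ _ e2)/nbhs_ballP[r1 /= r10 cF].
move/cvgrPdist_lt: cG => /(_ _ e2)/nbhs_ballP[r2 /= r20 cG].
have [|y [z [yr zr Eyz]]] := FG (Num.min r1 r2).
  by rewrite lt_min r10 r20.
move: yr zr; rewrite !lt_min ![`|_ - x|]distrC => /andP[y1 _] /andP[_ z2].
have {}/cF /= yP : ball x r1 y by rewrite -ball_normE.
have {}/cG /= zP : ball x r2 z by rewrite -ball_normE.
have := ltxx e; rewrite {1}/e (_ : F x - G x = (F x - F y) - (G x - G z)).
  by rewrite (le_lt_trans (ler_normB _ _))// [ltRHS](splitr e) ltrD.
by rewrite Eyz; ring.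
Qed.

(** One second difference, read in both orders, equals [t ^+ 2] times either mixed derivative at
    points arbitrarily close to [x]; continuity carries the equality to [x]. *)
Lemma derive_comm (R : realType) (V : normedModType R) (h : V -> R) (x v w : V) :
  (\forall y \near x, [/\ derivable h y v, derivable h y w,
     derivable ('D_v h) y w & derivable ('D_w h) y v]) ->
  {for x, continuous ('D_w ('D_v h))} -> {for x, continuous ('D_v ('D_w h))} ->
  'D_w ('D_v h) x = 'D_v ('D_w h) x.
Proof.
move=> /nbhs_ballP[r0 /= r00 hx] cwv cvw.
apply: (@continuous_eq_at _ _ ('D_w ('D_v h)) ('D_v ('D_w h)) x cwv cvw) => r1 r10.
pose r := Num.min r0 r1.
have rgt0 : 0 < r by rewrite lt_min r00.
have {}hx y : `|y - x| < r -> [/\ derivable h y v, derivable h y w,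
    derivable ('D_v h) y w & derivable ('D_w h) y v].
  by rewrite lt_min => /andP[y0 _]; apply: (hx y); rewrite -ball_normE /= distrC.
(* The summand 1 keeps the denominator positive when both directions vanish, and makes the
   inequality [tr] strict. *)
pose t := r / (`|v| + `|w| + 1).
have vw0 : 0 <= `|v| + `|w| by rewrite addr_ge0.
have t0 : 0 < t by rewrite divr_gt0// ltr_pwDr.
have tr : t * (`|v| + `|w|) < r.
  by rewrite mulrAC ltr_pdivrMr ?ltr_pwDr// ltr_pM2l// ltrDl.
have [|y yr Ey] := @second_difference _ _ h x v w r t _ t0 tr.
  by move=> y /hx[].
rewrite addrC in tr.
have [|z zr Ez] := @second_difference _ _ h x w v r t _ t0 tr.
  by move=> z /hx[].
have rr1 : r <= r1 by rewrite ge_min lexx orbT.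
exists y, z; split; [exact: lt_le_trans yr _|exact: lt_le_trans zr _|].
apply: (mulfI (_ : t ^+ 2 != 0)); first by rewrite sqrf_eq0 gt_eqF.
by rewrite -Ey -Ez (addrAC x); ring.
Qed.

(** * Smooth functions on an open set *)

(** The difference [e] of the two functions vanishes near [x], hence is little-o with differential
    0, and [g] is [f + e]. *)
Lemma differentiable_near_eq (R : realType) (V W : normedModType R)
    (f g : V -> W) (x : V) :
  (\near x, f x = g x) -> differentiable f x -> differentiable g x.
Proof.
move=> fg df; pose e (y : V) : W := g y - f y.
have e0 : \near x, e x = 0 
  by move: fg; apply: filterS => y fgy; rewrite /e fgy subrr.
have eo : e \o shift x = cst (e x) + (\0 : {linear V -> W}) +o_ 0 id.
  apply/eqaddoP => _/posnumP[eps].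
  move: e0; rewrite (near_shift 0 x) /= subr0; apply: filterS => y /= ey.
  rewrite -![(_ - _ : _ -> _) _]/(_ - _) -![(_ + _ : _ -> _) _]/(_ + _) /=.
  rewrite ey /e (nbhs_singleton fg) subrr.
  by rewrite addr0 subr0 normr0 mulr_ge0.
have de : 'd e x = (\0 : {linear V -> W}) :> (V -> W).
  by apply: (@diff_unique _ _ _ e (\0 : {linear V -> W}) x _ eo); exact: cst_continuous.
have -> : g = f + e.
  by apply/funext => y; rewrite /e /= -[RHS]/(f y + (g y - f y)) addrC subrK.
apply: differentiableD => //; apply/diff_locallyP; rewrite de; split => //.
exact: cst_continuous.
Qed.

Section Partial.
Variables (R : realType) (n : nat).
Implicit Types (h f g : 'rV[R]_n -> R) (U : set 'rV[R]_n).

Lemma partial_cst (i : 'I_n) (c : R) x : partial i (cst c) x = 0.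
Proof. exact: derive_cst. Qed.

Lemma partialD i f g x : differentiable f x -> differentiable g x ->
  partial i (fun y => f y + g y) x = partial i f x + partial i g x.
Proof. by move=> df dg; apply: deriveD; exact: diff_derivable. Qed.

Lemma partialN i f x : differentiable f x ->
  partial i (fun y => - f y) x = - partial i f x.
Proof. by move=> df; apply: deriveN; exact: diff_derivable. Qed.

Lemma partialM i f g x : differentiable f x -> differentiable g x ->
  partial i (fun y => f y * g y) x = partial i f x * g x + f x * partial i g x.
Proof.
move=> df dg; rewrite /partial [LHS]deriveM; [|exact: diff_derivable..].
by rewrite addrC /GRing.scale /= (mulrC (g x)).
Qed.

Lemma partialV i f x : differentiable f x -> f x != 0 ->
  partial i (fun y => (f y)^-1) x = - (partial i f x * ((f x)^-1 * (f x)^-1)).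
Proof.
move=> df fx; rewrite /partial [LHS]deriveV//; last exact: diff_derivable.
by rewrite /GRing.scale /= mulNr mulrC -exprVn expr2.
Qed.

Lemma partial_near_eq i f g x :
  (\near x, f x = g x) -> partial i f x = partial i g x.
Proof. exact: near_eq_derive. Qed.

Lemma differentiable_bigsum (I : Type) (r : seq I) (P : pred I)
    (F : I -> 'rV[R]_n -> R) x :
  (forall k, P k -> differentiable (F k) x) ->
  differentiable (fun y => \sum_(k <- r | P k) F k y) x.
Proof.
move=> dF; elim: r => [|k r IH].
  by under eq_fun do rewrite big_nil; exact: differentiable_cst.
under eq_fun do rewrite big_cons; case: (boolP (P k)) => // Pk.
by apply: differentiableD => //; exact: dF.
Qed.

Lemma partial_sum (I : Type) (r : seq I) (P : pred I) i
    (F : I -> 'rV[R]_n -> R) x :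
  (forall k, P k -> differentiable (F k) x) ->
  partial i (fun y => \sum_(k <- r | P k) F k y) x
    = \sum_(k <- r | P k) partial i (F k) x.
Proof.
move=> dF; elim: r => [|k r IH].
  by under eq_fun do rewrite big_nil; rewrite big_nil; exact: partial_cst.
under eq_fun do rewrite big_cons; rewrite big_cons.
case: (boolP (P k)) => // Pk.
rewrite partialD ?IH//; [exact: dF|exact: differentiable_bigsum].
Qed.

(** Bounding the order of differentiation makes induction on the order possible; closure of smooth
    functions under the algebraic operations is proved at each order and then transferred. *)
Definition Ck_on (k : nat) U h := forall s : seq 'I_n, (size s <= k)%N ->
  forall x, U x -> differentiable (foldr (@partial R n) h s) x.

Lemma smooth_on_Ck U h : smooth_on U h <-> forall k, Ck_on k U h.
Proof.
split=> [H k s _|H s]; first exact: H.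
exact: (H (size s)).
Qed.

(** In [foldr] the last direction of the list is differentiated first, so the innermost derivative
    is peeled off with [rcons]. *)
Lemma Ck_onS k U h : Ck_on k.+1 U h <->
  (forall x, U x -> differentiable h x) /\ forall i, Ck_on k U (partial i h).
Proof.
split=> [H|[H0 H]].
  split=> [x Ux|i s sk x Ux]; first exact: (H [::]).
  by have := H (rcons s i); rewrite size_rcons foldr_rcons; exact.
elim/last_ind => [|s i _]; first by move=> _; exact: H0.
by rewrite size_rcons foldr_rcons => sk; apply: H.
Qed.

Lemma Ck_on0 U h : Ck_on 0 U h <-> forall x, U x -> differentiable h x.
Proof.
split=> [H x Ux|H [|//] _ x Ux]; [exact: (H [::])|exact: H].
Qed.

Lemma Ck_onW k U h : Ck_on k.+1 U h -> Ck_on k U h.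
Proof. by move=> H s sk; apply: H; exact: leq_trans sk _. Qed.

Lemma near_in_open U (P : 'rV[R]_n -> Prop) x :
  open U -> U x -> (forall y, U y -> P y) -> \near x, P x.
Proof.
move=> oU Ux UP; near=> y; apply: UP; near: y.
exact: open_nbhs_nbhs.
Unshelve. all: by end_near. Qed.

(** On an open set, equality at all points is equality near each point, and this survives every
    partial derivative. Fields given in a chart are controlled on its image only, so smoothness is
    always transported in this way. *)
Lemma Ck_on_ext k U f g : open U -> (forall x, U x -> f x = g x) ->
  Ck_on k U f -> Ck_on k U g.
Proof.
move=> oU fg Hf s sk x Ux; apply: differentiable_near_eq (Hf s sk x Ux).
apply: (near_in_open oU Ux) => {Hf sk x Ux} y Uy.
elim: s y Uy => [|i s IH] y Uy /=; first exact: fg.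
by apply: partial_near_eq; exact: (near_in_open oU Uy).
Qed.

Lemma Ck_on_cst k U (c : R) : Ck_on k U (cst c).
Proof.
elim: k c => [|k IH] c; first by apply/Ck_on0 => x _; exact: differentiable_cst.
apply/Ck_onS; split=> [x _|i]; first exact: differentiable_cst.
rewrite (_ : partial i _ = cst 0) //; apply/funext => x; exact: partial_cst.
Qed.

Lemma Ck_onD k U f g : open U -> Ck_on k U f -> Ck_on k U g ->
  Ck_on k U (fun x => f x + g x).
Proof.
move=> oU; elim: k f g => [|k IH] f g.
  move=> /Ck_on0 hf /Ck_on0 hg; apply/Ck_on0 => x Ux.
  by apply: differentiableD; [exact: hf|exact: hg].
move=> /Ck_onS[hf hf'] /Ck_onS[hg hg']; apply/Ck_onS; split=> [x Ux|i].
  by apply: differentiableD; [exact: hf|exact: hg].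
apply: Ck_on_ext (IH _ _ (hf' i) (hg' i)) => // x Ux.
by rewrite partialD//; [exact: hf|exact: hg].
Qed.

(** The product rule involves undifferentiated factors as well, which are known to a higher order
    than needed; [Ck_onW] lowers it. *)
Lemma Ck_onM k U f g : open U -> Ck_on k U f -> Ck_on k U g ->
  Ck_on k U (fun x => f x * g x).
Proof.
move=> oU; elim: k f g => [|k IH] f g.
  move=> /Ck_on0 hf /Ck_on0 hg; apply/Ck_on0 => x Ux.
  by apply: differentiableM; [exact: hf|exact: hg].
move=> hf0 hg0; move: (hf0) (hg0) => /Ck_onS[hf hf'] /Ck_onS[hg hg'].
apply/Ck_onS; split=> [x Ux|i].
  by apply: differentiableM; [exact: hf|exact: hg].
have hM := Ck_onD oU (IH _ _ (hf' i) (Ck_onW hg0)) (IH _ _ (Ck_onW hf0) (hg' i)).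
apply: Ck_on_ext hM => // x Ux.
by rewrite partialM//; [exact: hf|exact: hg].
Qed.

(** The derivative of the inverse is minus [f'] times the square of the inverse, and the inverse is
    already controlled at the lower order. *)
Lemma Ck_onV k U f : open U -> (forall x, U x -> f x != 0) -> Ck_on k U f ->
  Ck_on k U (fun x => (f x)^-1).
Proof.
move=> oU f0; elim: k => [|k IH].
  move=> /Ck_on0 hf; apply/Ck_on0 => x Ux.
  by apply: differentiableV; [exact: hf|exact: f0].
move=> hf0; move: (hf0) => /Ck_onS[hf hf']; apply/Ck_onS; split=> [x Ux|i].
  by apply: differentiableV; [exact: hf|exact: f0].
have hV := IH (Ck_onW hf0).
have hM := Ck_onM oU (@Ck_on_cst k U (-1)) (Ck_onM oU (hf' i) (Ck_onM oU hV hV)).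
apply: Ck_on_ext hM => // x Ux.
by rewrite partialV ?mulN1r//; [exact: hf|exact: f0].
Qed.

Lemma smooth_on_diff U h x : smooth_on U h -> U x -> differentiable h x.
Proof. by move=> H; exact: (H [::]). Qed.

Lemma smooth_on_partial U h i : smooth_on U h -> smooth_on U (partial i h).
Proof. by move=> /smooth_on_Ck H; apply/smooth_on_Ck => k; case/Ck_onS: (H k.+1). Qed.

Lemma smooth_on_ext U f g : open U -> (forall x, U x -> f x = g x) ->
  smooth_on U f -> smooth_on U g.
Proof.
by move=> oU fg /smooth_on_Ck H; apply/smooth_on_Ck => k; exact: Ck_on_ext (H k).
Qed.

Lemma smooth_on_cst U (c : R) : smooth_on U (cst c).
Proof. by apply/smooth_on_Ck => k; exact: Ck_on_cst. Qed.

Lemma smooth_onD U f g : open U -> smooth_on U f -> smooth_on U g ->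
  smooth_on U (fun x => f x + g x).
Proof.
by move=> oU /smooth_on_Ck hf /smooth_on_Ck hg; apply/smooth_on_Ck => k; exact: Ck_onD.
Qed.

Lemma smooth_onM U f g : open U -> smooth_on U f -> smooth_on U g ->
  smooth_on U (fun x => f x * g x).
Proof.
by move=> oU /smooth_on_Ck hf /smooth_on_Ck hg; apply/smooth_on_Ck => k; exact: Ck_onM.
Qed.

Lemma smooth_onV U f : open U -> (forall x, U x -> f x != 0) -> smooth_on U f ->
  smooth_on U (fun x => (f x)^-1).
Proof.
by move=> oU f0 /smooth_on_Ck hf; apply/smooth_on_Ck => k; exact: Ck_onV.
Qed.

Lemma smooth_onN U f : open U -> smooth_on U f -> smooth_on U (fun x => - f x).
Proof.
move=> oU hf; apply: smooth_on_ext (smooth_onM oU (@smooth_on_cst U (-1)) hf) => //.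
by move=> x _; rewrite mulN1r.
Qed.

Lemma smooth_onB U f g : open U -> smooth_on U f -> smooth_on U g ->
  smooth_on U (fun x => f x - g x).
Proof. by move=> oU hf hg; apply: smooth_onD => //; exact: smooth_onN. Qed.

Lemma smooth_on_sum U (I : Type) (r : seq I) (P : pred I)
    (F : I -> 'rV[R]_n -> R) : open U ->
  (forall k, smooth_on U (F k)) ->
  smooth_on U (fun x => \sum_(k <- r | P k) F k x).
Proof.
move=> oU hF; elim: r => [|k r IH].
  under eq_fun do rewrite big_nil; exact: smooth_on_cst.
under eq_fun do rewrite big_cons; case: (P k) => //.
exact: smooth_onD.
Qed.

Lemma smooth_on_prod U (I : Type) (r : seq I) (P : pred I)
    (F : I -> 'rV[R]_n -> R) : open U ->
  (forall k, smooth_on U (F k)) ->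
  smooth_on U (fun x => \prod_(k <- r | P k) F k x).
Proof.
move=> oU hF; elim: r => [|k r IH].
  under eq_fun do rewrite big_nil; exact: smooth_on_cst.
under eq_fun do rewrite big_cons; case: (P k) => //.
exact: smooth_onM.
Qed.

Lemma partial_comm U h i j x : open U -> smooth_on U h -> U x ->
  partial i (partial j h) x = partial j (partial i h) x.
Proof.
move=> oU hh Ux; apply: derive_comm.
- apply: (near_in_open oU Ux) => y Uy; split; apply: diff_derivable.
  + exact: smooth_on_diff hh Uy.
  + exact: smooth_on_diff hh Uy.
  + exact: smooth_on_diff (smooth_on_partial j hh) Uy.
  + exact: smooth_on_diff (smooth_on_partial i hh) Uy.
- apply: differentiable_continuous.
  exact: smooth_on_diff (smooth_on_partial i (smooth_on_partial j hh)) Ux.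
- apply: differentiable_continuous.
  exact: smooth_on_diff (smooth_on_partial j (smooth_on_partial i hh)) Ux.
Qed.

End Partial.

(** * Chain rule and matrix-valued functions *)

Section ChainRule.
Variables (R : realType) (m n : nat).
Implicit Types (T : 'rV[R]_m -> 'rV[R]_n) (h : 'rV[R]_n -> R).

Lemma differentiable_rV T x :
  (forall k, differentiable (fun y => T y 0 k) x) -> differentiable T x.
Proof.
move=> dT.
have -> : T = \sum_(k < n) (fun y => T y 0 k *: (delta_mx 0 k : 'rV[R]_n)).
  by apply/funext => y; rewrite fct_sumE [LHS]row_sum_delta.
by apply: differentiable_sum => k; apply: differentiableZl; exact: dT.
Qed.

Lemma derive_partial h (v : 'rV[R]_n) x : differentiable h x ->
  'D_v h x = \sum_(a < n) v 0 a * partial a h x.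
Proof.
move=> dh; rewrite deriveE// {1}(row_sum_delta v) linear_sum.
by apply: eq_bigr => a _; rewrite linearZ /= /partial deriveE.
Qed.

Lemma derive_rV T (v : 'rV[R]_m) x : (forall k, differentiable (fun y => T y 0 k) x) ->
  'd T x v = \row_k 'D_v (fun y => T y 0 k) x.
Proof.
move=> dT; rewrite -deriveE; last exact: differentiable_rV.
rewrite derive_mx; last by apply: diff_derivable; exact: differentiable_rV.
by apply/rowP => k; rewrite !mxE.
Qed.

Lemma jacobianE T x a k : (forall k, differentiable (fun y => T y 0 k) x) ->
  ('J T x) a k = partial a (fun y => T y 0 k) x.
Proof.
by move=> dT; rewrite mxE derive_rV// mxE.
Qed.

Lemma differentiable_comp_rV T h x :
  (forall k, differentiable (fun y => T y 0 k) x) -> differentiable h (T x) ->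
  differentiable (h \o T) x.
Proof.
by move=> dT dh; apply: differentiable_comp => //; exact: differentiable_rV.
Qed.

Lemma partial_comp T h x a :
  (forall k, differentiable (fun y => T y 0 k) x) -> differentiable h (T x) ->
  partial a (fun y => h (T y)) x = \sum_(k < n) ('J T x) a k * partial k h (T x).
Proof.
move=> dT dh; rewrite /partial deriveE; last exact: (differentiable_comp_rV dT dh).
rewrite -[fun y => _]/(h \o T) diff_comp//; last exact: differentiable_rV.
rewrite /= -deriveE// derive_partial//; apply: eq_bigr => k _.
by rewrite derive_rV// mxE jacobianE.
Qed.

End ChainRule.

(** In a ball inside [U], the segment from [x] to [y] stays in the ball, and the mean value theorem
    along it compares the two values. *)
Lemma locally_constant_of_partial0 (R : realType) (n : nat) (U : set 'rV[R]_n)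
    (h : 'rV[R]_n -> R) (x : 'rV[R]_n) :
  open U -> (forall y, U y -> differentiable h y) ->
  (forall y a, U y -> partial a h y = 0) -> U x -> \forall y \near x, h y = h x.
Proof.
move=> oU dh h0 Ux; have /nbhs_ballP[r /= r0 rU] : nbhs x U.
  exact: open_nbhs_nbhs.
apply/nbhs_ballP; exists r => // y; rewrite -ball_normE /= => xy.
pose phi (t : R) := h (x + t *: (y - x)).
have dphi (t : R) : 0 <= t <= 1 -> is_derive t 1 phi 0.
  move=> /andP[t0 t1].
  have Ut : U (x + t *: (y - x)).
    apply: rU; rewrite -ball_normE /= opprD addNKr normrN normrZ ger0_norm//.
    by rewrite distrC (le_lt_trans _ xy)// ler_piMl.
  have <- : 'D_(y - x) h (x + t *: (y - x)) = 0.
    rewrite derive_partial; last exact: dh.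
    by rewrite big1// => a _; rewrite h0// mulr0.
  by apply: is_derive_line; apply: diff_derivable; exact: dh.
have [||c _] := MVT (f := phi) (df := fun=> 0) (@ltr01 R).
- by move=> t; rewrite in_itv /= => /andP[/ltW t0 /ltW t1]; apply: dphi; rewrite t0.
- apply: derivable_within_continuous => t; rewrite in_itv /= => t01.
  by have [] := dphi _ t01.
rewrite mul0r /phi scale1r scale0r addr0 (addrC x) subrK => /eqP.
by rewrite subr_eq0 => /eqP.
Qed.

Section MatrixDerivative.
Variables (R : realType) (n : nat).

Definition differentiable_mx p q (A : 'rV[R]_n -> 'M[R]_(p, q)) x :=
  forall i j, differentiable (fun y => A y i j) x.

Definition smooth_mx U p q (A : 'rV[R]_n -> 'M[R]_(p, q)) :=
  forall i j, smooth_on U (fun y => A y i j).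

Definition partial_mx p q (a : 'I_n) (A : 'rV[R]_n -> 'M[R]_(p, q)) x
  : 'M[R]_(p, q) := \matrix_(i, j) partial a (fun y => A y i j) x.

Lemma smooth_mx_diff U p q (A : 'rV[R]_n -> 'M[R]_(p, q)) x :
  smooth_mx U A -> U x -> differentiable_mx A x.
Proof. by move=> sA Ux i j; exact: smooth_on_diff (sA i j) Ux. Qed.

Section Rules.
Variables (p q r : nat) (a : 'I_n) (x : 'rV[R]_n).
Implicit Types (A B : 'rV[R]_n -> 'M[R]_(p, q)) (C : 'rV[R]_n -> 'M[R]_(q, r)).

Lemma partial_mx_near_eq A B :
  (\near x, A x = B x) -> partial_mx a A x = partial_mx a B x.
Proof.
move=> AB; apply/matrixP => i j; rewrite !mxE; apply: partial_near_eq.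
by move: AB; apply: filterS => y ->.
Qed.

Lemma partial_mx_cst (A : 'M[R]_(p, q)) : partial_mx a (fun=> A) x = 0.
Proof. by apply/matrixP => i j; rewrite !mxE partial_cst. Qed.

Lemma partial_mxD A B : differentiable_mx A x -> differentiable_mx B x ->
  partial_mx a (fun y => A y + B y) x = partial_mx a A x + partial_mx a B x.
Proof.
move=> dA dB; apply/matrixP => i j; rewrite !mxE -partialD//.
by congr (partial a _ x); apply/funext => y; rewrite mxE.
Qed.

Lemma partial_mxN A : differentiable_mx A x ->
  partial_mx a (fun y => - A y) x = - partial_mx a A x.
Proof.
move=> dA; apply/matrixP => i j; rewrite !mxE -partialN//.
by congr (partial a _ x); apply/funext => y; rewrite mxE.
Qed.

Lemma partial_mx_tr A :
  partial_mx a (fun y => (A y)^T) x = (partial_mx a A x)^T.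
Proof.
apply/matrixP => i j; rewrite !mxE.
by congr (partial a _ x); apply/funext => y; rewrite mxE.
Qed.

Lemma differentiable_mxM A C : differentiable_mx A x -> differentiable_mx C x ->
  differentiable_mx (fun y => A y *m C y) x.
Proof.
move=> dA dC i j; rewrite (_ : (fun y => _) = fun y => \sum_k A y i k * C y k j).
  by apply: differentiable_bigsum => k _; exact: differentiableM.
by apply/funext => y; rewrite mxE.
Qed.

Lemma partial_mxM A C : differentiable_mx A x -> differentiable_mx C x ->
  partial_mx a (fun y => A y *m C y) x
    = partial_mx a A x *m C x + A x *m partial_mx a C x.
Proof.
move=> dA dC; apply/matrixP => i j; rewrite !mxE -big_split /=.
under [X in partial a X]eq_fun do rewrite mxE.
rewrite partial_sum; last by move=> k _; exact: differentiableM.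
by apply: eq_bigr => k _; rewrite partialM// !mxE.
Qed.

End Rules.

Section Closure.
Variables (U : set 'rV[R]_n) (oU : open U) (p q r : nat).
Implicit Types (A B : 'rV[R]_n -> 'M[R]_(p, q)) (C : 'rV[R]_n -> 'M[R]_(q, r)).

Lemma smooth_mx_ext A B : (forall x, U x -> A x = B x) ->
  smooth_mx U A -> smooth_mx U B.
Proof.
by move=> AB sA i j; apply: (smooth_on_ext oU _ (sA i j)) => x /AB ->.
Qed.

Lemma smooth_mxD A B : smooth_mx U A -> smooth_mx U B ->
  smooth_mx U (fun x => A x + B x).
Proof.
move=> sA sB i j; apply: (smooth_on_ext oU _ (smooth_onD oU (sA i j) (sB i j))).
by move=> x _; rewrite mxE.
Qed.

Lemma smooth_mxN A : smooth_mx U A -> smooth_mx U (fun x => - A x).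
Proof.
move=> sA i j; apply: (smooth_on_ext oU _ (smooth_onN oU (sA i j))).
by move=> x _; rewrite mxE.
Qed.

Lemma smooth_mx_tr A : smooth_mx U A -> smooth_mx U (fun x => (A x)^T).
Proof.
move=> sA i j; apply: (smooth_on_ext oU _ (sA j i)).
by move=> x _; rewrite mxE.
Qed.

Lemma smooth_mxZ (f : 'rV[R]_n -> R) A : smooth_on U f -> smooth_mx U A ->
  smooth_mx U (fun x => f x *: A x).
Proof.
move=> sf sA i j; apply: (smooth_on_ext oU _ (smooth_onM oU sf (sA i j))).
by move=> x _; rewrite mxE.
Qed.

Lemma smooth_mxM A C : smooth_mx U A -> smooth_mx U C ->
  smooth_mx U (fun x => A x *m C x).
Proof.
move=> sA sC i j.
have H := smooth_on_sum (index_enum 'I_q) xpredT oU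
  (fun k => smooth_onM oU (sA i k) (sC k j)).
by apply: (smooth_on_ext oU _ H) => x _; rewrite mxE.
Qed.

Lemma smooth_mx_partial A a : smooth_mx U A -> smooth_mx U (partial_mx a A).
Proof.
move=> sA i j; apply: (smooth_on_ext oU _ (smooth_on_partial a (sA i j))).
by move=> x _; rewrite mxE.
Qed.

Lemma partial_mx_comm A a b x : smooth_mx U A -> U x ->
  partial_mx a (partial_mx b A) x = partial_mx b (partial_mx a A) x.
Proof.
move=> sA Ux; apply/matrixP => i j; rewrite [LHS]mxE [RHS]mxE.
have E c : (fun y => partial_mx c A y i j) = partial c (fun y => A y i j).
  by apply/funext => y; rewrite mxE.
rewrite !E; exact: partial_comm (sA i j) Ux.
Qed.

End Closure.

Lemma smooth_on_det U p (A : 'rV[R]_n -> 'M[R]_p) : open U ->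
  smooth_mx U A -> smooth_on U (fun x => \det (A x)).
Proof.
move=> oU sA; apply: smooth_on_sum => // s; apply: smooth_onM => //.
  exact: smooth_on_cst.
by apply: smooth_on_prod => // i; exact: sA.
Qed.

(** By Cramer's rule the inverse is the adjugate divided by the determinant, both polynomial in the
    entries. *)
Lemma smooth_mx_inv U p (A : 'rV[R]_n -> 'M[R]_p) : open U ->
  smooth_mx U A -> (forall x, U x -> A x \in unitmx) ->
  smooth_mx U (fun x => invmx (A x)).
Proof.
move=> oU sA uA.
have sadj : smooth_mx U (fun x => \adj (A x)).
  move=> i j; under [X in smooth_on _ X]eq_fun do rewrite mxE.
  apply: smooth_onM => //; first exact: smooth_on_cst.
  apply: smooth_on_det => // k l.
  by under [X in smooth_on _ X]eq_fun do rewrite !mxE; exact: sA.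
have := smooth_mxZ oU (smooth_onV oU _ (smooth_on_det oU sA)) sadj.
move=> H; apply: (smooth_mx_ext oU _ (H _)) => x Ux.
  by rewrite /invmx uA.
by have := uA _ Ux; rewrite unitmxE unitfE.
Qed.

(** Obtained by differentiating the product of the inverse with [A], which is constantly 1 on
    [U]. *)
Lemma partial_mx_inv U p (A : 'rV[R]_n -> 'M[R]_p) a x : open U ->
  smooth_mx U A -> (forall x, U x -> A x \in unitmx) -> U x ->
  partial_mx a (fun y => invmx (A y)) x
    = - (invmx (A x) *m partial_mx a A x *m invmx (A x)).
Proof.
move=> oU sA uA Ux.
have sV := smooth_mx_inv oU sA uA.
have : partial_mx a (fun y => invmx (A y) *m A y) x = 0.
  rewrite -[RHS](partial_mx_cst a x (1%:M : 'M[R]_p)); apply: partial_mx_near_eq.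
  by apply: (near_in_open oU Ux) => y Uy; rewrite mulVmx// uA.
rewrite partial_mxM; [|exact: smooth_mx_diff sV Ux|exact: smooth_mx_diff sA Ux].
move/eqP; rewrite addr_eq0 => /eqP /(congr1 (mulmx^~ (invmx (A x)))).
by rewrite mulmxK ?uA// mulNmx.
Qed.

End MatrixDerivative.

(** * Curvature of a metric connection and Schur's identity *)

Lemma addmxE (R : pzRingType) p q (A B : 'M[R]_(p, q)) i j :
  (A + B) i j = A i j + B i j.
Proof. by rewrite mxE. Qed.

Lemma oppmxE (R : pzRingType) p q (A : 'M[R]_(p, q)) i j : (- A) i j = - A i j.
Proof. by rewrite mxE. Qed.

Lemma zeromxE (R : pzRingType) p q i j : (0 : 'M[R]_(p, q)) i j = 0.
Proof. by rewrite mxE. Qed.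

Lemma trmxD (R : pzRingType) p q (A B : 'M[R]_(p, q)) : (A + B)^T = A^T + B^T.
Proof. exact: linearD. Qed.

Lemma trmxN (R : pzRingType) p q (A : 'M[R]_(p, q)) : (- A)^T = - A^T.
Proof. exact: linearN. Qed.

(** Identities between noncommuting matrices: once products are expanded into monomials, the entries
    of the monomials serve as atoms of a commutative ring identity. *)
Ltac mx_expand := rewrite ?(mulmxDl, mulmxDr, mulmxBl, mulmxBr, mulNmx, mulmxN, mulmxA).
Ltac mx_cancel := let i := fresh in let j := fresh in
  apply/matrixP => i j; rewrite ?(addmxE, oppmxE, zeromxE); ring.

Section Connection.
Variables (R : realType) (n : nat).

(* Matrices act on row vectors from the right: for (A a x)_bk = Gamma^k_ab, the
   entry (c, l) is R^l_cab; whence the order of the factors in the commutator. *)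
Definition curvature_mx (A : 'I_n -> 'rV[R]_n -> 'M[R]_n) (a b : 'I_n) (x : 'rV[R]_n)
    : 'M[R]_n :=
  partial_mx a (A b) x - partial_mx b (A a) x + A b x *m A a x - A a x *m A b x.

Variables (U : set 'rV[R]_n) (A : 'I_n -> 'rV[R]_n -> 'M[R]_n).
Hypotheses (oU : open U) (sA : forall a, smooth_mx U (A a)).
Local Notation F := (curvature_mx A).

Lemma curvature_mx_anti a b x : F b a x = - F a b x.
Proof. by rewrite /curvature_mx; mx_cancel. Qed.

Lemma smooth_curvature_mx a b : smooth_mx U (F a b).
Proof.
apply: smooth_mxD => //; last first.
  by apply: smooth_mxN => //; exact: smooth_mxM.
apply: smooth_mxD => //; last exact: smooth_mxM.
apply: smooth_mxD => //; first exact: smooth_mx_partial.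
by apply: smooth_mxN => //; exact: smooth_mx_partial.
Qed.

(** This is the Jacobi identity for the covariant derivatives, whose commutators are the curvature.
    After expansion, second derivatives cancel because partials commute, and all other terms cancel
    as monomials in the [A]'s and their first derivatives. *)
Lemma second_bianchi a b c x : U x ->
  (partial_mx c (F a b) x + F a b x *m A c x - A c x *m F a b x)
  + (partial_mx a (F b c) x + F b c x *m A a x - A a x *m F b c x)
  + (partial_mx b (F c a) x + F c a x *m A b x - A b x *m F c a x) = 0.
Proof.
move=> Ux.
have dA e : differentiable_mx (A e) x by exact: smooth_mx_diff (sA e) Ux.
have dpA e f : differentiable_mx (partial_mx e (A f)) x.
  exact: smooth_mx_diff (smooth_mx_partial oU e (sA f)) Ux.
have dM e f : differentiable_mx (fun y => A e y *m A f y) x.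
  exact: smooth_mx_diff (smooth_mxM oU (sA e) (sA f)) Ux.
have dN p q (B : 'rV[R]_n -> 'M[R]_(p, q)) :
    differentiable_mx B x -> differentiable_mx (fun y => - B y) x.
  move=> dB i j; rewrite (_ : (fun y => _) = (fun y => - B y i j)); last first.
    by apply/funext => y; rewrite oppmxE.
  exact: differentiableN.
have dD p q (B C : 'rV[R]_n -> 'M[R]_(p, q)) : differentiable_mx B x ->
    differentiable_mx C x -> differentiable_mx (fun y => B y + C y) x.
  move=> dB dC i j; rewrite (_ : (fun y => _) = (fun y => B y i j + C y i j)).
    exact: differentiableD.
  by apply/funext => y; rewrite addmxE.
have key e f h : partial_mx e (F f h) x =
   partial_mx e (partial_mx f (A h)) x - partial_mx e (partial_mx h (A f)) x
   + (partial_mx e (A h) x *m A f x + A h x *m partial_mx e (A f) x)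
   - (partial_mx e (A f) x *m A h x + A f x *m partial_mx e (A h) x).
  rewrite /curvature_mx partial_mxD; [|by auto|by auto].
  rewrite partial_mxD; [|by auto|by auto].
  rewrite partial_mxD; [|by auto|by auto].
  by rewrite !partial_mxN; auto; rewrite !partial_mxM.
rewrite !key (partial_mx_comm oU c a (sA b) Ux) (partial_mx_comm oU a b (sA c) Ux).
rewrite (partial_mx_comm oU b c (sA a) Ux) /curvature_mx.
(* Replacing the derivatives by variables leaves a polynomial identity in noncommuting matrices. *)
move: (partial_mx a (partial_mx c (A b)) x) (partial_mx b (partial_mx a (A c)) x).
move: (partial_mx c (partial_mx b (A a)) x) => D1 D2 D3.
move: (partial_mx a (A b) x) (partial_mx b (A a) x) (partial_mx b (A c) x) => E1 E2 E3.
move: (partial_mx c (A b) x) (partial_mx a (A c) x) (partial_mx c (A a) x) => E4 E5 E6.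
by mx_expand; mx_cancel.
Qed.

Variable G : 'rV[R]_n -> 'M[R]_n.
Hypotheses (sG : smooth_mx U G) (uG : forall x, U x -> G x \in unitmx).
Hypothesis compat : forall a x, U x ->
  partial_mx a G x = A a x *m G x + G x *m (A a x)^T.

(** Differentiating the compatibility equation once more gives both mixed second derivatives of [G];
    their difference is 0, and it is the left-hand side here up to expansion. *)
Lemma curvature_mx_skew a b x : U x -> F a b x *m G x + G x *m (F a b x)^T = 0.
Proof.
move=> Ux.
have dA e : differentiable_mx (A e) x by exact: smooth_mx_diff (sA e) Ux.
have dAT e : differentiable_mx (fun y => (A e y)^T) x.
  exact: smooth_mx_diff (smooth_mx_tr oU (sA e)) Ux.
have dG : differentiable_mx G x by exact: smooth_mx_diff sG Ux.
have key e f : partial_mx e (partial_mx f G) x =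
    (partial_mx e (A f) x *m G x + A f x *m (A e x *m G x + G x *m (A e x)^T))
    + ((A e x *m G x + G x *m (A e x)^T) *m (A f x)^T + G x *m (partial_mx e (A f) x)^T).
  rewrite -partial_mx_tr -compat// -partial_mxM// -partial_mxM//.
  rewrite -partial_mxD.
  - by apply: partial_mx_near_eq; apply: (near_in_open oU Ux) => y; exact: compat.
  - exact: smooth_mx_diff (smooth_mxM oU (sA f) sG) Ux.
  - exact: smooth_mx_diff (smooth_mxM oU sG (smooth_mx_tr oU (sA f))) Ux.
have := partial_mx_comm oU a b sG Ux; rewrite !key => /eqP.
rewrite -subr_eq0 => /eqP <-; rewrite /curvature_mx.
rewrite !(trmxD, trmxN, trmx_mul).
move: (partial_mx a (A b) x) (partial_mx b (A a) x) => E1 E2.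
by mx_expand; mx_cancel.
Qed.

(* The components R^{ml}_{ab} of the curvature with both Lie-algebra indices
   raised: contracting them against a, b involves no metric. *)
Definition raised_curvature a b x : 'M[R]_n := invmx (G x) *m F a b x.
Local Notation K := raised_curvature.

Hypothesis symG : forall x, U x -> (G x)^T = G x.

Lemma smooth_raised_curvature a b : smooth_mx U (K a b).
Proof.
by apply: smooth_mxM => //; [exact: smooth_mx_inv|exact: smooth_curvature_mx].
Qed.

Lemma raised_curvature_anti a b x : K b a x = - K a b x.
Proof. by rewrite /K curvature_mx_anti mulmxN. Qed.

(** Multiply [curvature_mx_skew] by the inverse of [G] on both sides and use the symmetry of [G]. *)
Lemma raised_curvature_skew a b x m l : U x -> K a b x m l = - K a b x l m.
Proof.
move=> Ux; suff : (K a b x)^T = - K a b x.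
  by move/matrixP => /(_ l m); rewrite mxE oppmxE.
rewrite /K trmx_mul trmx_inv symG// -mulmxN.
have /eqP := curvature_mx_skew a b Ux; rewrite addrC addr_eq0 => /eqP.
move/(congr1 (fun B => invmx (G x) *m B *m invmx (G x))).
rewrite !mulmxA mulVmx ?uG// mul1mx => ->.
by rewrite !mulmxN mulNmx mulmxA mulmxK ?uG.
Qed.

(** Raising an index commutes with covariant differentiation: compatibility makes the derivative of
    the inverse metric equal to [- (invmx G *m A + A^T *m invmx G)]. Its first term supplies the
    left half of the commutator and its second cancels the [A^T] term, so the identity is
    [second_bianchi] multiplied by [invmx G]. *)
Lemma raised_bianchi a b c x : U x ->
  (partial_mx c (K a b) x + (A c x)^T *m K a b x + K a b x *m A c x)
  + (partial_mx a (K b c) x + (A a x)^T *m K b c x + K b c x *m A a x)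
  + (partial_mx b (K c a) x + (A b x)^T *m K c a x + K c a x *m A b x) = 0.
Proof.
move=> Ux.
have dV := smooth_mx_diff (smooth_mx_inv oU sG uG) Ux.
have dF f h := smooth_mx_diff (smooth_curvature_mx f h) Ux.
have key e f h : partial_mx e (K f h) x + (A e x)^T *m K f h x + K f h x *m A e x
   = invmx (G x) *m (partial_mx e (F f h) x + F f h x *m A e x - A e x *m F f h x).
  rewrite /K partial_mxM.
  - rewrite (partial_mx_inv e oU sG uG Ux) (compat e Ux).
    have -> : invmx (G x) *m (A e x *m G x + G x *m (A e x)^T) *m invmx (G x)
        = invmx (G x) *m A e x + (A e x)^T *m invmx (G x).
      by rewrite mulmxDr mulmxDl !mulmxA (mulVmx (uG Ux)) mul1mx (mulmxK (uG Ux)).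
    move: (partial_mx e (F f h) x) (invmx (G x)) (F f h x) (A e x) => D V C B.
    by mx_expand; mx_cancel.
  - exact: dV.
  - exact: dF.
rewrite (key c a b) (key a b c) (key b c a) -mulmxDr.
by rewrite -mulmxDr (second_bianchi a b c Ux) mulmx0.
Qed.

Hypothesis torsion_free : forall a b k x, U x -> A a x b k = A b x a k.
Variable mu : 'rV[R]_n -> R.
Hypothesis smu : smooth_on U mu.
Hypothesis einstein : forall x b c, U x ->
  \sum_a F a b x c a = mu x * G x b c.

(** The contraction is the Ricci tensor with one index raised, and raising an index of [mu] times
    the metric gives [mu] times the identity. *)
Lemma raised_trace b m x : U x -> \sum_a K a b x m a = mu x * (m == b)%:R.
Proof.
move=> Ux; under eq_bigr do rewrite mxE.
rewrite exchange_big /=; under eq_bigr do rewrite -mulr_sumr einstein// mulrCA.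
rewrite -mulr_sumr; congr (_ * _).
have /matrixP/(_ m b) := mulVmx (uG Ux); rewrite !mxE => <-.
by apply: eq_bigr => c _; rewrite -{2}(symG Ux) mxE.
Qed.

(** Summing the entries [(b, a)] of the raised Bianchi identity over [a] and [b] leaves [n - 1 - 1]
    copies of the derivative of [mu]. Of the six Christoffel sums, four are plus or minus [mu * tau]
    and cancel in pairs; the other two pair a symmetric with a skew factor. *)
Lemma einstein_partial0 c x : (n != 2)%N -> U x -> partial c mu x = 0.
Proof.
move=> n2 Ux.
have dK f h m l : differentiable (fun y => K f h y m l) x.
  exact: smooth_mx_diff (smooth_raised_curvature f h) Ux m l.
have dmu : differentiable mu x by exact: smooth_on_diff smu Ux.
pose dk e f h m l := partial e (fun y => K f h y m l) x.
have tr1 y b m : U y -> \sum_a K a b y m a = mu y * (m == b)%:R.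
  exact: raised_trace.
have tr2 y a l : U y -> \sum_b K a b y b l = mu y * (l == a)%:R.
  move=> Uy; rewrite -tr1//; apply: eq_bigr => b _.
  by rewrite raised_curvature_anti oppmxE -raised_curvature_skew.
have tr3 b m : \sum_a K b a x m a = - (mu x * (m == b)%:R).
  rewrite -tr1// -sumrN; apply: eq_bigr => a _.
  by rewrite raised_curvature_anti oppmxE.
have tr4 a l : \sum_b K b a x b l = - (mu x * (l == a)%:R).
  rewrite -tr2// -sumrN; apply: eq_bigr => b _.
  by rewrite raised_curvature_anti oppmxE.
have dmuE e (d : bool) : partial e (fun y => mu y * d%:R) x = partial e mu x * d%:R.
  have dc := @differentiable_cst R _ _ (d%:R : R) x.
  by rewrite (partialM e dmu dc) partial_cst mulr0 addr0.
have dtr1 e b m : \sum_a dk e a b m a = partial e mu x * (m == b)%:R.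
  rewrite -dmuE -partial_sum//.
  by apply: partial_near_eq; apply: (near_in_open oU Ux) => y; exact: tr1.
have dtr2 e a l : \sum_b dk e a b b l = partial e mu x * (l == a)%:R.
  rewrite -dmuE -partial_sum//.
  by apply: partial_near_eq; apply: (near_in_open oU Ux) => y; exact: tr2.
have dkN e f h m l : dk e f h m l = - dk e h f m l.
  rewrite /dk -partialN//; congr (partial e _ x); apply/funext => y.
  by rewrite raised_curvature_anti oppmxE.
have pick (X : 'I_n -> R) d : \sum_a X a * (a == d)%:R = X d.
  rewrite (bigD1 d)//= eqxx mulr1 big1 ?addr0// => a /negPf->.
  by rewrite mulr0.
(* Exchanging the two summations shows that the sum is its own negative. *)
have antisym0 (X : 'I_n -> 'I_n -> R) : (forall a k, X k a = - X a k) ->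
    \sum_a \sum_k X a k = 0.
  move=> XN; suff : \sum_a \sum_k X a k = - \sum_a \sum_k X a k by lra.
  rewrite {1}exchange_big /= -sumrN; apply: eq_bigr => a _.
  by rewrite -sumrN; apply: eq_bigr => k _.
(* The contracted Christoffel symbol; torsion-freeness identifies its two possible contractions. *)
pose tau := \sum_a A c x a a.
have tauE : \sum_a A a x c a = tau by apply: eq_bigr => a _; rewrite torsion_free.
have entryE e f h m l :
    (partial_mx e (K f h) x + (A e x)^T *m K f h x + K f h x *m A e x) m l
    = dk e f h m l + \sum_k A e x k m * K f h x k l
      + \sum_k K f h x m k * A e x k l.
  rewrite 2!addmxE; congr (_ + _ + _); rewrite [LHS]mxE //.
  by apply: eq_bigr => k _; rewrite [X in X * _]mxE.
have : \sum_a \sum_b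
   ((dk c a b b a + \sum_k A c x k b * K a b x k a + \sum_k K a b x b k * A c x k a)
  + (dk a b c b a + \sum_k A a x k b * K b c x k a + \sum_k K b c x b k * A a x k a)
  + (dk b c a b a + \sum_k A b x k b * K c a x k a + \sum_k K c a x b k * A b x k a))
   = 0.
  rewrite big1// => a _; rewrite big1// => b _.
  rewrite -(entryE c a b b a) -(entryE a b c b a) -(entryE b c a b a).
  by rewrite -2!addmxE (raised_bianchi a b c Ux) zeromxE.
under eq_bigr do rewrite !big_split /=.
rewrite !big_split /=.
have -> : \sum_a \sum_b dk c a b b a = n%:R * partial c mu x.
  rewrite exchange_big /=; under eq_bigr do rewrite dtr1 eqxx mulr1.
  by rewrite sumr_const card_ord mulr_natl.
have -> : \sum_a \sum_b \sum_k A c x k b * K a b x k a = mu x * tau.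
  rewrite exchange_big mulr_sumr /=; apply: eq_bigr => b _.
  rewrite exchange_big /= -(pick (fun k => mu x * A c x k b)).
  by apply: eq_bigr => k _; rewrite -mulr_sumr tr1//; ring.
have -> : \sum_a \sum_b \sum_k K a b x b k * A c x k a = mu x * tau.
  rewrite mulr_sumr /=; apply: eq_bigr => a _.
  rewrite exchange_big /= -(pick (fun k => mu x * A c x k a)).
  by apply: eq_bigr => k _; rewrite -mulr_suml tr2//; ring.
have -> : \sum_a \sum_b dk a b c b a = - partial c mu x.
  rewrite -(pick (fun a => - partial a mu x)); apply: eq_bigr => a _.
  by rewrite mulNr -dtr2 -sumrN; apply: eq_bigr => b _.
(* For fixed [b] the Christoffel factor is symmetric in [a] and [k] by torsion-freeness, while the
   raised curvature is skew in them. *)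
have -> : \sum_a \sum_b \sum_k A a x k b * K b c x k a = 0.
  rewrite exchange_big big1//= => b _; apply: antisym0 => a k.
  by rewrite torsion_free// (raised_curvature_skew b c a k)// mulrN.
have -> : \sum_a \sum_b \sum_k K b c x b k * A a x k a = - (mu x * tau).
  rewrite -tauE mulr_sumr -sumrN; apply: eq_bigr => a _.
  rewrite exchange_big /= -(pick (fun k => - (mu x * A a x k a))).
  by apply: eq_bigr => k _; rewrite -mulr_suml tr4//; ring.
have -> : \sum_a \sum_b dk b c a b a = - partial c mu x.
  rewrite exchange_big /= -(pick (fun a => - partial a mu x)).
  apply: eq_bigr => b _.
  by rewrite mulNr -dtr1 -sumrN; apply: eq_bigr => a _.
have -> : \sum_a \sum_b \sum_k A b x k b * K c a x k a = - (mu x * tau).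
  rewrite exchange_big /= -tauE mulr_sumr -sumrN; apply: eq_bigr => b _.
  rewrite exchange_big /= -(pick (fun k => - (mu x * A b x k b))).
  by apply: eq_bigr => k _; rewrite -mulr_sumr tr3//; ring.
have -> : \sum_a \sum_b \sum_k K c a x b k * A b x k a = 0.
  rewrite big1// => a _; apply: antisym0 => b k.
  by rewrite torsion_free// (raised_curvature_skew c a k b)// mulNr.
move=> E; have : (n%:R - 2) * partial c mu x = 0 by rewrite -E; ring.
move/eqP; rewrite mulf_eq0 subr_eq0 eqr_nat (negPf n2) => /orP[//|/eqP//].
Qed.

End Connection.

(** * The Levi-Civita connection of a chart *)

(* A tensor symmetric in its first two and skew in its last two indices is 0. *)
Lemma levi_civita_diff0 (R : realType) n (G : 'M[R]_n) (D : 'I_n -> 'M[R]_n) :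
  G \in unitmx -> G^T = G -> (forall a b k, D a b k = D b a k) ->
  (forall a, D a *m G + G *m (D a)^T = 0) -> forall a, D a = 0.
Proof.
move=> uG sG Dsym Dcompat a.
pose S a b c := (D a *m G) b c.
have Ssym e f h : S e f h = S f e h.
  by rewrite /S !mxE; apply: eq_bigr => k _; rewrite Dsym.
have Sskew e f h : S e f h = - S e h f.
  have /matrixP/(_ f h) := Dcompat e.
  rewrite addmxE zeromxE -{2}sG -trmx_mul [X in _ + X]mxE => /eqP.
  by rewrite addr_eq0 => /eqP.
have S0 e f h : S e f h = 0.
  have : S e f h = - S e f h.
    (* Alternating the two symmetries returns the indices to their original order after three sign
       changes. *)
    by rewrite {1}Ssym Sskew Ssym Sskew opprK Ssym Sskew.
  lra.
rewrite -[LHS](mulmxK uG) (_ : D a *m G = 0) ?mul0mx//.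
by apply/matrixP => b c; rewrite zeromxE -[LHS]/(S a b c).
Qed.

Section Chart.
Variables (R : realType) (n : nat) (M : manifold R n) (g : tensor02 M).
Hypothesis pr : pseudo_riemannian g.
Variable i : atlas M.
Local Notation U := (img i).

Definition connection_mx (a : 'I_n) (x : 'rV[R]_n) : 'M[R]_n :=
  \matrix_(b, k) christoffel g i k a b x.

Let oU : open U. Proof. exact: img_open. Qed.

Let sG : smooth_mx U (g i). Proof. by case: pr => sg _ _ _ a b; exact: sg. Qed.

Let symG x : U x -> (g i x)^T = g i x. Proof. by case: pr => _ + _ _; exact. Qed.

Let uG x : U x -> g i x \in unitmx. Proof. by case: pr => _ _ + _; exact. Qed.

Lemma smooth_christoffel k a b : smooth_on U (christoffel g i k a b).
Proof.
apply: (smooth_onM oU (@smooth_on_cst _ _ U (2^-1))).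
apply: (smooth_on_sum _ _ oU) => l.
apply: (smooth_onM oU); first exact: (smooth_mx_inv oU sG uG).
apply: (smooth_onB oU); last exact: smooth_on_partial (sG a b).
apply: (smooth_onD oU); first exact: smooth_on_partial (sG b l).
exact: smooth_on_partial (sG a l).
Qed.

Lemma smooth_connection_mx a : smooth_mx U (connection_mx a).
Proof.
move=> b k; apply: (smooth_on_ext oU _ (smooth_christoffel k a b)) => x _.
by rewrite mxE.
Qed.

Lemma partial_metric_sym l a b x : U x ->
  partial l (fun y => g i y a b) x = partial l (fun y => g i y b a) x.
Proof.
move=> Ux; apply: partial_near_eq; apply: (near_in_open oU Ux) => y Uy.
by rewrite -{1}(symG Uy) mxE.
Qed.

Lemma connection_mx_torsion a b k x : U x ->
  connection_mx a x b k = connection_mx b x a k.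
Proof.
move=> Ux; rewrite [LHS]mxE [RHS]mxE; congr (_ * _); apply: eq_bigr => l _.
by rewrite (partial_metric_sym l a b Ux) [X in _ * (X - _)]addrC.
Qed.

(** Multiplication by the metric cancels the inverse metric and yields the Christoffel symbols of
    the first kind, which are linear in the derivatives of [g]. *)
Lemma christoffel_lowered a b c x : U x ->
  (connection_mx a x *m g i x) b c = 2^-1 *
    (partial a (fun y => g i y b c) x + partial b (fun y => g i y a c) x
     - partial c (fun y => g i y a b) x).
Proof.
move=> Ux; rewrite mxE.
pose X l := partial a (fun y => g i y b l) x + partial b (fun y => g i y a l) x
     - partial l (fun y => g i y a b) x.
under eq_bigr do rewrite mxE /christoffel -mulrA.
rewrite -mulr_sumr; congr (_ * _).
under eq_bigr do rewrite mulr_suml.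
have GV l : \sum_k invmx (g i x) k l * g i x k c = (c == l)%:R.
  have /matrixP/(_ c l) := mulmxV (uG Ux); rewrite mxE [X in _ = X]mxE => <-.
  by apply: eq_bigr => k _; rewrite -{2}(symG Ux) mxE mulrC.
rewrite exchange_big /= -/(X c) (bigD1 c) //= [X in _ + X]big1 ?addr0 => [|l lc].
  under eq_bigr do rewrite mulrAC.
  by rewrite -mulr_suml GV eqxx mul1r.
under eq_bigr do rewrite mulrAC.
by rewrite -mulr_suml GV eq_sym (negPf lc) mul0r.
Qed.

(** By symmetry of the metric the second summand is the transpose of the first; when two symbols of
    the first kind with exchanged indices are added, only the derivative in direction [a]
    survives. *)
Lemma connection_mx_compat a x : U x ->
  partial_mx a (g i) x
    = connection_mx a x *m g i x + g i x *m (connection_mx a x)^T.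
Proof.
move=> Ux; rewrite -{2}(symG Ux) -trmx_mul; apply/matrixP => b c.
rewrite addmxE [X in _ + X]mxE !christoffel_lowered// [LHS]mxE.
rewrite (partial_metric_sym a c b Ux); lra.
Qed.

(** Uniqueness of the Levi-Civita connection, pointwise: the difference of two candidates satisfies
    the hypotheses of [levi_civita_diff0]. It yields the law of change of charts without
    transforming Christoffel symbols by hand. *)
Lemma connection_mx_unique (B : 'I_n -> 'M[R]_n) x : U x ->
  (forall a b k, B a b k = B b a k) ->
  (forall a, partial_mx a (g i) x = B a *m g i x + g i x *m (B a)^T) ->
  forall a, B a = connection_mx a x.
Proof.
move=> Ux Bsym Bcompat a; apply/eqP; rewrite -subr_eq0; apply/eqP.
move: a; apply: (@levi_civita_diff0 _ _ (g i x)) => //.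
- exact: uG.
- exact: symG.
- move=> a b k; rewrite !addmxE !oppmxE Bsym; congr (_ - _).
  exact: connection_mx_torsion.
- move=> a; have := Bcompat a; rewrite (connection_mx_compat a Ux) => /eqP.
  rewrite eq_sym -subr_eq0 => /eqP <-; rewrite linearB /=.
  by mx_expand; mx_cancel.
Qed.

Lemma curvatureE l c a b x :
  curvature g i l c a b x = curvature_mx connection_mx a b x c l.
Proof.
rewrite /curvature_mx 3!addmxE 2!oppmxE /curvature -[RHS]addrA.
have E e f : (fun y => connection_mx e y c f) = christoffel g i f e c.
  by apply/funext => y; rewrite mxE.
congr (_ - _ + _); [by rewrite mxE E|by rewrite mxE E|].
rewrite sumrB; congr (_ - _); rewrite [RHS]mxE; apply: eq_bigr => m _.
  by rewrite !mxE mulrC.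
by rewrite !mxE mulrC.
Qed.

Lemma ricciE b c x :
  ricci g i x b c = \sum_a curvature_mx connection_mx a b x c a.
Proof. by rewrite mxE; apply: eq_bigr => a _; rewrite curvatureE. Qed.

Lemma smooth_ricci : smooth_mx U (ricci g i).
Proof.
move=> b c.
have H := smooth_on_sum (index_enum 'I_n) xpredT oU
  (fun a => smooth_curvature_mx oU smooth_connection_mx a b c a).
by apply: (smooth_on_ext oU _ H) => x _; rewrite ricciE.
Qed.

Lemma smooth_scalar_curvature : smooth_on U (scalar_curvature g i).
Proof.
apply: (smooth_on_sum _ _ oU) => b; apply: (smooth_on_sum _ _ oU) => c.
exact: (smooth_onM oU (smooth_mx_inv oU sG uG b c) (smooth_ricci b c)).
Qed.

Lemma schur_chart (mu : 'rV[R]_n -> R) c x : (n != 2)%N ->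
  smooth_on U mu -> (forall x, U x -> ricci g i x = mu x *: g i x) -> U x ->
  partial c mu x = 0.
Proof.
move=> n2 smu ein Ux.
apply: (einstein_partial0 oU smooth_connection_mx sG uG
  connection_mx_compat symG _ smu _ c n2 Ux).
- by move=> a b k y Uy; exact: connection_mx_torsion.
- by move=> y b d Uy; rewrite -ricciE ein// mxE.
Qed.

End Chart.

(** * Change of charts *)

Section Transformation.
Variables (R : realType) (n : nat) (M : manifold R n) (g : tensor02 M).
Hypothesis pr : pseudo_riemannian g.
Variables i j : atlas M.
Local Notation O := (overlap i j).
Local Notation T := (transition i j).
Local Notation A := (connection_mx g i).
Local Notation A' := (connection_mx g j).
Local Notation J := (fun x => 'J T x).

Lemma overlap_open : open O.
Proof.
rewrite openE => x [Ux Tx]; apply: filterI.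
  by apply: open_nbhs_nbhs; split=> //; exact: img_open.
by apply: (param_cont Ux); apply: open_nbhs_nbhs; split=> //; exact: dom_open.
Qed.
Let oO := overlap_open.

Lemma overlap_img x : O x -> img i x. Proof. by case. Qed.

Lemma transition_img x : O x -> img j (T x).
Proof. by case=> _ Tx; exists (param i x). Qed.

Lemma transition_diff x : O x -> forall k, differentiable (fun y => T y 0 k) x.
Proof.
by move=> Ox k; exact: (smooth_on_diff (@transition_smooth _ _ M i j k) Ox).
Qed.

Lemma jacobian_transitionE x a k : O x ->
  'J T x a k = partial a (fun y => T y 0 k) x.
Proof. by move=> Ox; rewrite jacobianE//; exact: transition_diff. Qed.

Lemma smooth_jacobian : smooth_mx O J.
Proof.
move=> a k; apply: (smooth_on_ext oO _
  (smooth_on_partial a (@transition_smooth _ _ M i j k))) => x Ox.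
by rewrite jacobian_transitionE.
Qed.
Let dJ x : O x -> differentiable_mx J x := smooth_mx_diff smooth_jacobian.

(** Both sides are second derivatives of a component of the transition map. *)
Lemma partial_jacobian_sym a b k x : O x ->
  partial_mx a J x b k = partial_mx b J x a k.
Proof.
have E e f y : O y -> partial_mx e J y f k
    = partial e (partial f (fun y => T y 0 k)) y.
  move=> Oy; rewrite mxE; apply: partial_near_eq.
  by apply: (near_in_open oO Oy) => z Oz; exact: jacobian_transitionE.
move=> Ox; apply: etrans (E a b x Ox) (etrans _ (esym (E b a x Ox))).
exact: (partial_comm a b oO (@transition_smooth _ _ M i j k) Ox).
Qed.

Lemma partial_mx_comp p q (C : 'rV[R]_n -> 'M[R]_(p, q)) a x : O x ->
  differentiable_mx C (T x) ->
  differentiable_mx (fun y => C (T y)) x /\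
  partial_mx a (fun y => C (T y)) x
    = \sum_k 'J T x a k *: partial_mx k C (T x).
Proof.
move=> Ox dC; split=> [b c|].
  exact: (differentiable_comp_rV (transition_diff Ox) (dC b c)).
apply/matrixP => b c; rewrite summxE [LHS]mxE.
rewrite (partial_comp a (transition_diff Ox) (dC b c)).
by apply: eq_bigr => k _; rewrite !mxE.
Qed.

Let symG k x : img k x -> (g k x)^T = g k x. Proof. by case: pr => _ + _ _; exact. Qed.
Let uG k x : img k x -> g k x \in unitmx. Proof. by case: pr => _ _ + _; exact. Qed.
Let trG x : O x -> g i x = J x *m g j (T x) *m (J x)^T.
Proof. by case: pr => _ _ _; exact. Qed.
Let dG x : img j x -> differentiable_mx (g j) x.
Proof. by case: pr => sg _ _ _ Ux a b; exact: smooth_on_diff (sg j a b) Ux. Qed.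

(** Invertibility is read off the transformation law of the metric: [J] is the left factor of the
    invertible matrix [g i x]. *)
Lemma jacobian_unit x : O x -> J x \in unitmx.
Proof.
move=> Ox; have := mulmxV (uG (overlap_img Ox)).
by rewrite {1}trG// -!mulmxA => /mulmx1_unit[].
Qed.

(** Only the direction index is pulled back through the transition map; the matrix indices still
    refer to the frame of chart [j]. The change of frame is the conjugation by [J] in the gauge
    law. *)
Definition pullback_connection a x : 'M[R]_n := \sum_k 'J T x a k *: A' k (T x).
Local Notation B := pullback_connection.

(** The gauge law. Solved for the connection in chart [i], its right-hand side is torsion-free and
    compatible with [g i], so uniqueness of the Levi-Civita connection gives the equality. *)
Lemma connection_mx_transition a x : O x ->
  A a x *m J x = partial_mx a J x + J x *m B a x.
Proof.
move=> Ox; have uJ := jacobian_unit Ox; have Tx := transition_img Ox.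
rewrite -(connection_mx_unique pr (overlap_img Ox)
  (B := fun a => (partial_mx a J x + J x *m B a x) *m invmx (J x))) ?mulmxKV//.
(* Torsion-freeness: the first summand is a Hessian, and the second is symmetric because the
   connection of chart [j] is torsion-free. *)
- move=> e b k; rewrite [LHS]mxE [RHS]mxE; apply: eq_bigr => c _; congr (_ * _).
  apply: etrans (addmxE _ _ _ _) (etrans _ (esym (addmxE _ _ _ _))).
  congr (_ + _); first exact: partial_jacobian_sym.
  have JB f d : (J x *m B f x) d c
      = \sum_p \sum_q 'J T x d p * ('J T x f q * A' q (T x) p c).
    rewrite [LHS]mxE; apply: eq_bigr => p _.
    rewrite summxE mulr_sumr; apply: eq_bigr => q _.
    by congr (_ * _); rewrite [LHS]mxE.
  apply: etrans (JB e b) (etrans _ (esym (JB b e))).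
  rewrite exchange_big /=; apply: eq_bigr => p _; apply: eq_bigr => q _.
  by rewrite mulrCA; congr (_ * (_ * _)); exact: connection_mx_torsion.
(* Compatibility: differentiate the transformation law [g i = J g_j J^T] with the product rule,
   using compatibility in chart [j] for the middle factor. *)
- move=> e.
  have [dC pC] := partial_mx_comp e Ox (dG Tx).
  have -> : partial_mx e (g i) x
      = partial_mx e (fun y => J y *m g j (T y) *m (J y)^T) x.
    by apply: partial_mx_near_eq; apply: (near_in_open oO Ox); exact: trG.
  have dJC : differentiable_mx (fun y => J y *m g j (T y)) x.
    exact: differentiable_mxM (dJ Ox) dC.
  have dJT : differentiable_mx (fun y => (J y)^T) x.
    exact: smooth_mx_diff (smooth_mx_tr oO smooth_jacobian) Ox.
  rewrite (partial_mxM _ dJC dJT) (partial_mxM _ (dJ Ox) dC).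
  have -> : partial_mx e (fun y => g j (T y)) x
      = B e x *m g j (T x) + g j (T x) *m (B e x)^T.
    rewrite pC /B linear_sum mulmx_suml mulmx_sumr -big_split.
    apply: eq_bigr => k _; rewrite (connection_mx_compat pr k Tx) scalerDr.
    by rewrite /= linearZ /= -scalemxAl -scalemxAr.
  have uJT : (J x)^T \in unitmx by rewrite unitmx_tr.
  rewrite (trG Ox) partial_mx_tr.
  move: (partial_mx e J x) (B e x) (g j (T x)) (J x) uJ uJT => D1 D2 D3 D4 uJ uJT.
  rewrite trmx_mul trmx_inv !mulmxA (mulmxKV uJ) (mulmxK uJT).
  by rewrite trmxD trmx_mul; mx_expand; mx_cancel.
Qed.

(** Two facts are combined: the curvature of the pulled-back connection is the pull-back of the
    curvature, and a gauge change conjugates the curvature. The latter follows by differentiating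
    the gauge law and antisymmetrizing in [a] and [b]. *)
Lemma curvature_mx_transition a b x : O x ->
  curvature_mx A a b x *m J x = J x *m
    \sum_p \sum_q ('J T x a p * 'J T x b q) *: curvature_mx A' p q (T x).
Proof.
move=> Ox; have Tx := transition_img Ox; have Ux := overlap_img Ox.
have dA e : differentiable_mx (A e) x := smooth_mx_diff (smooth_connection_mx pr e) Ux.
have dA' e : differentiable_mx (A' e) (T x) :=
  smooth_mx_diff (smooth_connection_mx pr e) Tx.
have dAT e : differentiable_mx (fun y => A' e (T y)) x.
  exact: (partial_mx_comp a Ox (dA' e)).1.
have BE e : B e = fun y => \sum_q 'J T y e q *: A' q (T y) by [].
have dB e : differentiable_mx (B e) x.
  move=> c d; rewrite (_ : (fun y => _) = fun y => \sum_q 'J T y e q * A' q (T y) c d).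
    apply: differentiable_bigsum => q _.
    by apply: differentiableM; [exact: dJ|exact: dAT].
  by apply/funext => y; rewrite summxE; apply: eq_bigr => q _; rewrite [LHS]mxE.
have pB e f : partial_mx e (B f) x = \sum_q (partial_mx e J x f q *: A' q (T x)
    + 'J T x f q *: \sum_p 'J T x e p *: partial_mx p (A' q) (T x)).
  apply/matrixP => c d; rewrite summxE [LHS]mxE.
  rewrite (_ : (fun y => _) = fun y => \sum_q 'J T y f q * A' q (T y) c d).
    rewrite partial_sum => [|q _]; last first.
      by apply: differentiableM; [exact: dJ|exact: dAT].
    apply: eq_bigr => q _; rewrite (partialM _ (dJ Ox f q) (dAT q c d)).
    rewrite addmxE; congr (_ + _); first by rewrite [RHS]mxE [partial_mx _ _ _ _ _]mxE.
    rewrite [RHS]mxE; congr (_ * _).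
    by have /matrixP/(_ c d) := (partial_mx_comp e Ox (dA' q)).2; rewrite [LHS]mxE.
  by apply/funext => y; rewrite summxE; apply: eq_bigr => q _; rewrite [LHS]mxE.
have gauge e f : partial_mx e (A f) x *m J x + A f x *m partial_mx e J x
    = partial_mx e (partial_mx f J) x
      + (partial_mx e J x *m B f x + J x *m partial_mx e (B f) x).
  rewrite -(partial_mxM _ (dA f) (dJ Ox)) -(partial_mxM _ (dJ Ox) (dB f)).
  rewrite -partial_mxD.
  - apply: partial_mx_near_eq; apply: (near_in_open oO Ox).
    exact: connection_mx_transition.
  - exact: smooth_mx_diff (smooth_mx_partial oO f smooth_jacobian) Ox.
  - exact: differentiable_mxM (dJ Ox) (dB f).
have -> : \sum_p \sum_q ('J T x a p * 'J T x b q) *: curvature_mx A' p q (T x)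
    = curvature_mx B a b x.
  have split4 (c : 'I_n -> 'I_n -> R) (W1 W2 W3 W4 : 'I_n -> 'I_n -> 'M[R]_n) :
      \sum_p \sum_q c p q *: (W1 p q - W2 p q + W3 p q - W4 p q)
      = \sum_p \sum_q c p q *: W1 p q - \sum_p \sum_q c p q *: W2 p q
        + \sum_p \sum_q c p q *: W3 p q - \sum_p \sum_q c p q *: W4 p q.
    rewrite -sumrB -big_split -sumrB /=; apply: eq_bigr => p _.
    rewrite -sumrB -big_split -sumrB /=; apply: eq_bigr => q _.
    by rewrite scalerBr scalerDr scalerBr.
  have BB e f : B e x *m B f x
      = \sum_p \sum_q ('J T x e p * 'J T x f q) *: (A' p (T x) *m A' q (T x)).
    rewrite [LHS]mulmx_suml; apply: eq_bigr => p _.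
    rewrite mulmx_sumr; apply: eq_bigr => q _.
    by rewrite -scalemxAl -scalemxAr scalerA.
  have Y e f : \sum_q 'J T x f q *: \sum_p 'J T x e p *: partial_mx p (A' q) (T x)
      = \sum_p \sum_q ('J T x e p * 'J T x f q) *: partial_mx p (A' q) (T x).
    rewrite [RHS]exchange_big /=; apply: eq_bigr => q _.
    by rewrite scaler_sumr; apply: eq_bigr => p _; rewrite scalerA mulrC.
  have swap (W : 'I_n -> 'I_n -> 'M[R]_n) :
      \sum_p \sum_q ('J T x b p * 'J T x a q) *: W p q
      = \sum_p \sum_q ('J T x a p * 'J T x b q) *: W q p.
    rewrite exchange_big /=; apply: eq_bigr => p _; apply: eq_bigr => q _.
    by rewrite mulrC.
  have dBE e f : partial_mx e (B f) x = \sum_q partial_mx e J x f q *: A' q (T x)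
      + \sum_p \sum_q ('J T x e p * 'J T x f q) *: partial_mx p (A' q) (T x).
    by apply: etrans (pB e f) _; rewrite big_split /=; congr (_ + _); exact: Y.
  (* The second derivatives of the transition map enter both derivatives of [B] equally, so they
     drop out of the curvature. *)
  have Hess : \sum_q partial_mx b J x a q *: A' q (T x)
      = \sum_q partial_mx a J x b q *: A' q (T x).
    by apply: eq_bigr => q _; congr (_ *: _); exact: partial_jacobian_sym.
  have E2 := etrans (dBE b a) (congr2 +%R Hess (swap _)).
  have E3 := etrans (BB b a) (swap _).
  have cancel (S P1 P2 P3 P4 Q1 Q2 Q3 Q4 : 'M[R]_n) :
      Q1 = S + P1 -> Q2 = S + P2 -> Q3 = P3 -> Q4 = P4 ->
      P1 - P2 + P3 - P4 = Q1 - Q2 + Q3 - Q4.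
    by move=> -> -> -> ->; mx_cancel.
  exact: etrans (split4 _ _ _ _ _) (cancel _ _ _ _ _ _ _ _ _ (dBE a b) E2 E3 (BB a b)).
have Ea := connection_mx_transition a Ox; have Eb := connection_mx_transition b Ox.
have gab := gauge a b; have gba := gauge b a.
rewrite (partial_mx_comm oO b a smooth_jacobian Ox) in gba.
rewrite /curvature_mx.
move: (partial_mx a (A b) x) (partial_mx b (A a) x) (partial_mx a (B b) x)
  (partial_mx b (B a) x) gab gba => D1 D2 D3 D4.
move: (partial_mx a (partial_mx b J) x) Ea Eb.
move: (partial_mx a J x) (partial_mx b J x) (A a x) (A b x) (B a x) (B b x) (J x).
move=> J1 J2 A1 A2 B1 B2 J0 H E1 E2 G1 G2.
(* Regrouped so that the first two brackets are sides of the differentiated gauge law and the inner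
   differences are given by the gauge law itself. *)
have -> : (D1 - D2 + A2 *m A1 - A1 *m A2) *m J0
  = (D1 *m J0 + A2 *m J1) - (D2 *m J0 + A1 *m J2)
    + (A2 *m (A1 *m J0 - J1) - A1 *m (A2 *m J0 - J2)).
  by mx_expand; mx_cancel.
rewrite G1 G2 E1 E2 (addrC J1) (addrC J2) !addrK !mulmxA E1 E2.
by mx_expand; mx_cancel.
Qed.

(** In the contraction over [a], the Jacobian from the direction index meets the inverse Jacobian
    from the conjugation and cancels it ([CJ]); one Jacobian remains for each of the two free
    indices. *)
Lemma ricci_transition x : O x ->
  ricci g i x = J x *m ricci g j (T x) *m (J x)^T.
Proof.
move=> Ox; have uJ := jacobian_unit Ox; apply/matrixP => b c.
rewrite ricciE.
have FE a : curvature_mx A a b x = J x *m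
    (\sum_p \sum_q ('J T x a p * 'J T x b q) *: curvature_mx A' p q (T x))
    *m invmx (J x).
  by rewrite -curvature_mx_transition// mulmxK.
pose C p q := J x *m curvature_mx A' p q (T x) *m invmx (J x).
have FC a : curvature_mx A a b x c a
    = \sum_q 'J T x b q * \sum_p C p q c a * 'J T x a p.
  rewrite FE mulmx_sumr mulmx_suml summxE.
  under eq_bigr do rewrite mulmx_sumr mulmx_suml summxE.
  rewrite exchange_big /=; apply: eq_bigr => q _; rewrite mulr_sumr.
  apply: eq_bigr => p _; rewrite -scalemxAr -scalemxAl [LHS]mxE -/(C p q).
  by ring.
under eq_bigr do rewrite FC.
rewrite exchange_big /= [RHS]mxE.
have CJ p q : \sum_a C p q c a * 'J T x a p
    = \sum_k 'J T x c k * curvature_mx A' p q (T x) k p.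
  transitivity ((C p q *m J x) c p); first by rewrite [RHS]mxE.
  by rewrite /C (mulmxKV uJ) [LHS]mxE.
transitivity (\sum_q 'J T x b q * \sum_k 'J T x c k * ricci g j (T x) q k).
  apply: eq_bigr => q _; rewrite -mulr_sumr; congr (_ * _).
  rewrite exchange_big /=; under eq_bigr do rewrite CJ.
  rewrite exchange_big /=; apply: eq_bigr => k _.
  by rewrite -mulr_sumr ricciE.
under [RHS]eq_bigr do rewrite mxE mulr_suml.
rewrite exchange_big /=; apply: eq_bigr => q _; rewrite mulr_sumr.
by apply: eq_bigr => k _; rewrite [X in _ = _ * X]mxE; ring.
Qed.

End Transformation.

(** * Schur's lemma and the product metric *)

Section Schur.
Variables (R : realType) (n : nat) (M : manifold R n) (g : tensor02 M).
Hypothesis pr : pseudo_riemannian g.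

Let uG i x : img i x -> g i x \in unitmx. Proof. by case: pr => _ _ + _; exact. Qed.

Lemma scalar_curvature_einstein i x (mu : R) : img i x ->
  ricci g i x = mu *: g i x -> scalar_curvature g i x = n%:R * mu.
Proof.
move=> Ux ein; rewrite /scalar_curvature ein.
have symG : (g i x)^T = g i x by case: pr => _ + _ _; exact.
transitivity (\sum_(b < n) mu); last by rewrite sumr_const card_ord mulr_natl.
apply: eq_bigr => b _.
have E : \sum_c invmx (g i x) b c * g i x c b = 1.
  by have /matrixP/(_ b b) := mulVmx (uG Ux); rewrite mxE [X in _ = X]mxE eqxx.
rewrite -[RHS]mulr1 -E mulr_sumr; apply: eq_bigr => c _.
have -> : g i x c b = g i x b c by rewrite -{1}symG mxE.
by rewrite [X in _ * X]mxE mulrCA.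
Qed.

Hypothesis n3 : (3 <= n)%N.
Variable mu : forall i : atlas M, 'rV[R]_n -> R.
Hypothesis smu : forall i, smooth_on (img i) (mu i).
Hypothesis ein : forall i x, img i x -> ricci g i x = mu i x *: g i x.

(** Both [ricci g] and [g] transform by the same law, so the two factors multiply the same
    invertible matrix [g i x]. *)
Lemma einstein_factor_transition i j x :
  overlap i j x -> mu i x = mu j (transition i j x).
Proof.
move=> Ox; have Ux := overlap_img Ox.
have trG : g i x = 'J (transition i j) x *m g j (transition i j x)
    *m ('J (transition i j) x)^T by case: pr => _ _ _; exact.
have := ricci_transition pr Ox; rewrite (ein Ux) (ein (transition_img Ox)).
rewrite -scalemxAr -scalemxAl -trG => /(congr1 (mulmx^~ (invmx (g i x)))).
rewrite -!scalemxAl (mulmxV (uG Ux)).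
(* A diagonal entry is needed to compare two multiples of the identity matrix. *)
have n0 : (0 < n)%N by exact: leq_trans n3.
move=> /matrixP/(_ (Ordinal n0) (Ordinal n0)).
by rewrite !mxE eqxx !mulr1.
Qed.

Lemma einstein_factor_locally_constant i x : img i x ->
  \forall y \near x, mu i y = mu i x.
Proof.
apply: (locally_constant_of_partial0 (@img_open _ _ M i)).
  by move=> y Uy; exact: (smooth_on_diff (@smu i) Uy).
move=> y a; apply: (schur_chart pr _ _ (@smu i) (ein (i:=i))).
by case: n n3 => [|[|[]]].
Qed.

(** The chart functions glue to one function [m] on the manifold, which is locally constant; its
    level sets are therefore open and closed, and connectedness leaves only one. *)
Lemma schur_lemma : connected [set: M] -> exists m : R,
  forall i x, img i x -> mu i x = m.
Proof.
move=> cM.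
(* On an empty manifold every constant works. *)
have [[p0 _]|M0] := pselect (exists p : M, True); last first.
  by exists 0 => i x [p _ _]; case: M0; exists p.
(* A chart is chosen at every point; [mE] shows that the value of [m] is independent of the
   choice. *)
pose ch (p : M) := projT1 (cid (dom_cover p)).
have chP p : dom (ch p) p by rewrite /ch; case: cid.
pose m p := mu (ch p) (Defs.coord (ch p) p).
have mE i p : dom i p -> m p = mu i (Defs.coord i p).
  move=> ip; rewrite /m (@einstein_factor_transition _ i) /transition ?coordK//.
  by split; [exists p|rewrite /= coordK].
have mloc p : \forall q \near p, m q = m p.
  have ip := chP p.
  have Ux : img (ch p) (Defs.coord (ch p) p) by exists p.
  have := coord_cont ip (einstein_factor_locally_constant Ux).
  have : nbhs p (dom (ch p)).
    by apply: open_nbhs_nbhs; split => //; exact: dom_open.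
  by apply: filterS2 => q iq E; rewrite (mE _ _ iq) [LHS]E.
have oP (P : set R) : open (m @^-1` P).
  rewrite openE => p Pp; move: (mloc p); apply: filterS => q qp.
  by rewrite /= qp.
have mT : m @^-1` [set m p0] = [set: M].
  apply: cM; first by exists p0.
    by exists (m @^-1` [set m p0]); rewrite ?setTI.
  exists (m @^-1` [set m p0]); rewrite ?setTI//.
  by rewrite -[X in closed X]setCK; apply: open_closedC; exact: (oP (~` [set m p0])).
exists (m p0) => i _ [p ip <-]; rewrite -mE//.
have : [set: M] p by []. 
by rewrite -mT.
Qed.

End Schur.

(** Schur's lemma applies to the scalar curvature divided by [n], whose smoothness comes from that
    of the metric. Tracing the soliton equation gives [mu = lambda + rho * n * mu], hence the
    formula for [lambda]. *)
Lemma killing_soliton_einstein (R : realType) (n : nat) (M : manifold R n)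
    (g : tensor02 M) (Z : vector_field M) (lambda : M -> R) (rho : R) :
  (3 <= n)%N -> pseudo_riemannian g -> connected [set: M] ->
  almost_ricci_bourguignon_soliton g Z lambda rho -> killing Z g ->
  exists mu : R, einstein_with g mu /\ forall p, lambda p = (1 - n%:R * rho) * mu.
Proof.
move=> n3 pr cM sol kil.
have n0 : n%:R != 0 :> R by rewrite pnatr_eq0 -lt0n (leq_trans _ n3).
have ein i x : img i x -> ricci g i x
    = (lambda (param i x) + rho * scalar_curvature g i x) *: g i x.
  by move=> Ux; rewrite -sol// kil// scaler0 addr0.
pose mu i x := n%:R^-1 * scalar_curvature g i x.
have muE i x : img i x ->
    mu i x = lambda (param i x) + rho * scalar_curvature g i x.
  move=> Ux; rewrite /mu {1}(scalar_curvature_einstein pr Ux (ein i x Ux)).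
  by rewrite mulKf.
have [||m mE] := schur_lemma pr n3 (mu := mu) _ _ cM.
- move=> i; apply: (smooth_onM (@img_open _ _ M i) (@smooth_on_cst _ _ _ _)).
  exact: smooth_scalar_curvature.
- by move=> i x Ux; rewrite muE// ein.
exists m; split=> [i x Ux|p]; first by rewrite -(mE i x)// muE// ein.
have [i ip] := dom_cover p.
have Ux : img i (Defs.coord i p) by exists p.
have := muE i _ Ux; rewrite coordK// => /esym/eqP; rewrite -subr_eq0 => /eqP E.
have S : scalar_curvature g i (Defs.coord i p) = n%:R * m.
  by rewrite -(mE i _ Ux) /mu mulVKf.
by move: E; rewrite S (mE i _ Ux) => E; lra.
Qed.

(** The difference quotients on the two sides coincide. For the projections of a product, [v] is a
    coordinate direction of the factor or 0. *)
Lemma partial_linear (R : realType) (m n : nat) (L : {linear 'rV[R]_m -> 'rV[R]_n})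
    (h : 'rV[R]_n -> R) (i : 'I_m) (v : 'rV[R]_n) (x : 'rV[R]_m) :
  L (delta_mx 0 i) = v -> partial i (fun y => h (L y)) x = 'D_v h (L x).
Proof.
move=> Li; rewrite /partial /derive /=.
by under eq_fun do rewrite linearP Li.
Qed.

(** * The twisted warped metric and its conformal rescaling *)

Section Product.
Variables (R : realType) (n1 n2 : nat) (M1 : manifold R n1) (M2 : manifold R n2).
Local Notation N := (product_manifold M1 M2).
Local Notation lsub := (@lsubmx R 1 n1 n2).
Local Notation rsub := (@rsubmx R 1 n1 n2).

Lemma lsubmx_delta_lshift a : lsub (delta_mx 0 (lshift n2 a)) = delta_mx 0 a.
Proof. by apply/rowP => l; rewrite !mxE /= eq_lshift. Qed.

Lemma lsubmx_delta_rshift b : lsub (delta_mx 0 (rshift n1 b)) = 0.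
Proof. by apply/rowP => l; rewrite !mxE /= eq_lrshift. Qed.

Lemma rsubmx_delta_lshift a : rsub (delta_mx 0 (lshift n2 a)) = 0.
Proof. by apply/rowP => l; rewrite !mxE /= eq_rlshift. Qed.

Lemma rsubmx_delta_rshift b : rsub (delta_mx 0 (rshift n1 b)) = delta_mx 0 b.
Proof. by apply/rowP => l; rewrite !mxE /= eq_rshift. Qed.

Lemma product_img (c : atlas N) x :
  img c x -> img c.1 (lsub x) /\ img c.2 (rsub x).
Proof.
move=> cx; have : (@product_coord _ _ _ M1 M2 c @` product_dom c) x by [].
by rewrite product_imgE => -[].
Qed.

Lemma smooth_on_lsubmx (c : atlas N) (h : 'rV[R]_n1 -> R) :
  smooth_on (img c.1) h -> smooth_on (img c) (fun x => h (lsub x)).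
Proof.
apply: (@smooth_on_linear _ _ _ (@lsubmx _ _ _ _)).
- by move=> x; exact: continuous_lsubmx.
- move=> i; rewrite -(fintype.splitK i); case: (fintype.split i) => k /=.
    by left; exists k; exact: lsubmx_delta_lshift.
  by right; exact: lsubmx_delta_rshift.
- by move=> x /product_img[].
Qed.

Lemma smooth_on_rsubmx (c : atlas N) (h : 'rV[R]_n2 -> R) :
  smooth_on (img c.2) h -> smooth_on (img c) (fun x => h (rsub x)).
Proof.
apply: (@smooth_on_linear _ _ _ (@rsubmx _ _ _ _)).
- by move=> x; exact: continuous_rsubmx.
- move=> i; rewrite -(fintype.splitK i); case: (fintype.split i) => k /=.
    by right; exact: rsubmx_delta_lshift.
  by left; exists k; exact: rsubmx_delta_rshift.
- by move=> x /product_img[].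
Qed.

Lemma product_overlap (c d : atlas N) x : overlap c d x ->
  overlap c.1 d.1 (lsub x) /\ overlap c.2 d.2 (rsub x).
Proof. by case=> /product_img[x1 x2] [y1 y2]. Qed.

Lemma product_transition_lsubmx (c d : atlas N) x :
  lsub (transition c d x) = transition c.1 d.1 (lsub x).
Proof. exact: row_mxKl. Qed.

Lemma product_transition_rsubmx (c d : atlas N) x :
  rsub (transition c d x) = transition c.2 d.2 (rsub x).
Proof. exact: row_mxKr. Qed.

(** Each block of components of the transition map factors through one projection; the off-diagonal
    blocks are derivatives along the zero vector. *)
Lemma product_jacobian (c d : atlas N) x : overlap c d x ->
  'J (transition c d) x = block_mx ('J (transition c.1 d.1) (lsub x)) 0
                                   0 ('J (transition c.2 d.2) (rsub x)).
Proof.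
move=> Ox; have [Ol Or] := product_overlap Ox.
have El b : (fun y => transition c d y 0 (lshift n2 b))
    = fun y => transition c.1 d.1 (lsub y) 0 b.
  by apply/funext => y; rewrite -product_transition_lsubmx [RHS]mxE.
have Er b : (fun y => transition c d y 0 (rshift n1 b))
    = fun y => transition c.2 d.2 (rsub y) 0 b.
  by apply/funext => y; rewrite -product_transition_rsubmx [RHS]mxE.
apply/matrixP => i k; rewrite (jacobian_transitionE i k Ox).
rewrite -(fintype.splitK i) -(fintype.splitK k).
case: (fintype.split i) => a; case: (fintype.split k) => b /=.
- rewrite El block_mxEul (jacobian_transitionE a b Ol).
  exact: (@partial_linear _ _ _ lsub
    (fun y => transition c.1 d.1 y 0 b) _ _ _ (lsubmx_delta_lshift a)).
- rewrite Er block_mxEur zeromxE.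
  apply: etrans (@partial_linear _ _ _ rsub
    (fun y => transition c.2 d.2 y 0 b) _ _ _ (rsubmx_delta_lshift a)) _.
  exact: derive0.
- rewrite El block_mxEdl zeromxE.
  apply: etrans (@partial_linear _ _ _ lsub
    (fun y => transition c.1 d.1 y 0 b) _ _ _ (lsubmx_delta_rshift a)) _.
  exact: derive0.
- rewrite Er block_mxEdr (jacobian_transitionE a b Or).
  exact: (@partial_linear _ _ _ rsub
    (fun y => transition c.2 d.2 y 0 b) _ _ _ (rsubmx_delta_rshift a)).
Qed.

(** Positivity of [phi] keeps the matrices invertible. The tensor law persists because [phi] is a
    function on the manifold: two charts evaluate it at the same point, by [coordK]. *)
Lemma pseudo_riemannian_conformal n (M : manifold R n) (g : tensor02 M)
    (phi : M -> R) :
  pseudo_riemannian g -> smooth_fun phi -> (forall p, 0 < phi p) ->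
  pseudo_riemannian (fun i x => phi (param i x) ^+ 2 *: g i x).
Proof.
move=> [sg symg ug trg] sphi phi0.
have phin0 p : phi p ^+ 2 \is a GRing.unit by rewrite unitfE sqrf_eq0 gt_eqF.
split=> [i a b|i x Ux|i x Ux|i j x Ox].
- have oU := @img_open _ _ M i.
  apply: (smooth_on_ext oU _
    (smooth_onM oU (smooth_onM oU (sphi i) (sphi i)) (sg i a b))) => x _.
  by rewrite [RHS]mxE expr2.
- by rewrite linearZ /= symg.
- by rewrite unitmxZ// ug.
- rewrite (trg i j x Ox) -scalemxAr -scalemxAl; congr (_ ^+ 2 *: _).
  by case: Ox => _ Tx; rewrite /transition coordK.
Qed.

(** Everything is checked blockwise. Since the Jacobian is block diagonal, the tensor law splits
    into those of the factors, the scalar [f ^+ 2] being the same in both charts. *)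
Lemma pseudo_riemannian_twisted_warped (g1 : tensor02 M1) (g2 : tensor02 M2)
    (f : N -> R) : pseudo_riemannian g1 -> pseudo_riemannian g2 ->
  smooth_fun f -> (forall p, 0 < f p) ->
  pseudo_riemannian (twisted_warped_metric g1 g2 f).
Proof.
move=> [sg1 symg1 ug1 trg1] [sg2 symg2 ug2 trg2] sf f0.
have fn0 p : f p ^+ 2 != 0 by rewrite sqrf_eq0 gt_eqF.
split=> [c i k|c x Ux|c x Ux|c d x Ox].
- have oU := @img_open _ _ N c.
  rewrite -(fintype.splitK i) -(fintype.splitK k).
  case: (fintype.split i) => a; case: (fintype.split k) => b /=.
  + apply: (smooth_on_ext oU _ (smooth_on_lsubmx (sg1 c.1 a b))) => x _.
    by rewrite [RHS]block_mxEul.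
  + apply: (smooth_on_ext oU _ (@smooth_on_cst _ _ _ 0)) => x _.
    by rewrite [RHS]block_mxEur zeromxE.
  + apply: (smooth_on_ext oU _ (@smooth_on_cst _ _ _ 0)) => x _.
    by rewrite [RHS]block_mxEdl zeromxE.
  + apply: (smooth_on_ext oU _ (smooth_onM oU (smooth_onM oU (sf c) (sf c))
      (smooth_on_rsubmx (sg2 c.2 a b)))) => x _.
    by rewrite [RHS]block_mxEdr [RHS]mxE expr2.
- have [U1 U2] := product_img Ux.
  by rewrite /twisted_warped_metric tr_block_mx !trmx0 linearZ /= symg1 ?symg2.
- have [U1 U2] := product_img Ux.
  rewrite unitmxE det_ublock unitrM detZ unitrM -!unitmxE ug1// ug2// andbT /=.
  by rewrite unitfE expf_neq0.
- have [Ol Or] := product_overlap Ox.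
  rewrite (product_jacobian Ox) /twisted_warped_metric tr_block_mx !trmx0.
  rewrite product_transition_lsubmx product_transition_rsubmx.
  rewrite 2!mulmx_block.
  rewrite !(mulmx0, mul0mx, addr0, add0r).
  rewrite -trg1// -scalemxAr -scalemxAl -trg2//.
  by case: Ox => _ Tx; rewrite /transition coordK.
Qed.

End Product.

Theorem corollary5p3 (R : realType) (n1 n2 : nat)
    (M1 : manifold R n1) (M2 : manifold R n2)
    (g1 : tensor02 M1) (g2 : tensor02 M2)
    (f phi : product_manifold M1 M2 -> R)
    (Z : vector_field (product_manifold M1 M2))
    (lambda : product_manifold M1 M2 -> R) (rho : R) :
  (0 < n1)%N -> (0 < n2)%N -> (3 <= n1 + n2)%N ->
  pseudo_riemannian g1 -> pseudo_riemannian g2 ->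
  smooth_fun f -> (forall p, 0 < f p) ->
  smooth_fun phi -> (forall p, 0 < phi p) ->
  connected [set: product_manifold M1 M2] ->
  smooth_vector_field Z -> smooth_fun lambda ->
  almost_ricci_bourguignon_soliton (lyra_metric g1 g2 f phi) Z lambda rho ->
  killing Z (lyra_metric g1 g2 f phi) ->
  exists mu : R,
    [/\ einstein_with (lyra_metric g1 g2 f phi) mu,
        forall p, lambda p = (1 - (n1 + n2)%:R * rho) * mu,
        exists c : R, forall p, lambda p = c,
        rho <> 1 / (n1 + n2)%:R ->
          forall p, mu = lambda p / (1 - (n1 + n2)%:R * rho)
      & rho = 1 / (n1 + n2)%:R -> forall p, lambda p = 0].
Proof.
move=> _ _ n3 prg1 prg2 sf f0 sphi phi0 cN _ _ sol kil.
(* The Lyra metric is by definition the rescaling of the twisted warped metric by [phi ^+ 2]. *)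
have prg := pseudo_riemannian_conformal
  (pseudo_riemannian_twisted_warped prg1 prg2 sf f0) sphi phi0.
have [mu [ein lamE]] := killing_soliton_einstein n3 prg cN sol kil.
have n0 : (n1 + n2)%:R != 0 :> R by rewrite pnatr_eq0 -lt0n (leq_trans _ n3).
exists mu; split=> //.
- by exists ((1 - (n1 + n2)%:R * rho) * mu).
- move=> rho1 p; rewrite lamE mulrAC mulfV ?mul1r// subr_eq0.
  apply/eqP => E; apply: rho1; apply: (mulfI n0).
  by rewrite -E mulrCA mulfV// mulr1.
- by move=> rhoE p; rewrite lamE rhoE mulrCA mulfV// mulr1 subrr mul0r.
Qed.
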